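(* Let $\mathbb{K}$ be a field, $V=\mathbb{K}^\ell$, and let $\mathcal{A}\neq\Phi_\ell$ be a central hyperplane arrangement in $V$. Let $\pi=(\pi_1,\ldots,\pi_s)$ be a partition of $\mathcal{A}$, let $H_0\in\pi_1$, and let $(\mathcal{A},\mathcal{A}',\mathcal{A}'')$ be the triple associated with $H_0$. Suppose that the restriction map $\mathrm{R}:\mathcal{A}\setminus\pi_1\to\mathcal{A}''$, $H\mapsto H\cap H_0$, is bijective. Then any two of the following statements imply the third: (i) $\kappa:[\pi_1]\otimes\cdots\otimes[\pi_s]\to A(\mathcal{A})$ is an isomorphism of graded $\mathbb{K}$-vector spaces; (ii) $\kappa':[\pi_1']\otimes\cdots\otimes[\pi_s']\to A(\mathcal{A}')$ is an isomorphism of graded $\mathbb{K}$-vector spaces; (iii) $\kappa'':[\pi_2'']\otimes\cdots\otimes[\pi_s'']\to A(\mathcal{A}'')$ is an isomorphism of graded $\mathbb{K}$-vector spaces.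
   Context: A central arrangement $\mathcal{A}$ in $V=\mathbb{K}^\ell$ is a finite set of linear hyperplanes of $V$; $\Phi_\ell$ is the empty arrangement. For $H_0\in\mathcal{A}$ the associated triple is $\mathcal{A}'=\mathcal{A}\setminus\{H_0\}$ and $\mathcal{A}''=\{H_0\cap H\mid H\in\mathcal{A}'\}$, an arrangement in $H_0$. A partition $\pi=(\pi_1,\ldots,\pi_s)$ of $\mathcal{A}$ is an ordered tuple of non-empty pairwise disjoint subsets with union $\mathcal{A}$. Given $\pi$ and $H_0\in\pi_1$: the induced partition $\pi'$ of $\mathcal{A}'$ consists of the non-empty sets $\pi_i'=\pi_i\cap\mathcal{A}'$; and $\pi''=(\pi_2'',\ldots,\pi_s'')$ with $\pi_i''=\mathrm{R}(\pi_i)=\{H\cap H_0\mid H\in\pi_i\}$ (a partition of $\mathcal{A}''$ when $\mathrm{R}$ is bijective). The Orlik–Solomon algebra $A(\mathcal{B})$ of an arrangement $\mathcal{B}$ is the graded anticommutative $\mathbb{K}$-algebra $E/I$, where $E$ is the exterior algebra on degree-one generators $e_H$ ($H\in\mathcal{B}$) and $I$ is the ideal generated by $\partial(e_{H_1}\cdots e_{H_p})=\sum_k(-1)^{k-1}e_{H_1}\cdots\widehat{e_{H_k}}\cdots e_{H_p}$ for all linearly dependent tuples $(H_1,\ldots,H_p)$ (i.e. $\operatorname{codim}(H_1\cap\cdots\cap H_p)<p$); $a_H$ denotes the image of $e_H$. For a subset $\sigma$ of $\mathcal{B}$ put $[\sigma]=\mathbb{K}+\sum_{H\in\sigma}\mathbb{K}a_H\subseteq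 A(\mathcal{B})$ (graded, with $1$ in degree $0$ and $a_H$ in degree $1$), and for a partition $(\sigma_1,\ldots,\sigma_t)$ of $\mathcal{B}$, $\kappa:[\sigma_1]\otimes\cdots\otimes[\sigma_t]\to A(\mathcal{B})$ is the $\mathbb{K}$-linear map induced by multiplication; $\kappa,\kappa',\kappa''$ are these maps for $\pi,\pi',\pi''$ (with $[\varnothing]=\mathbb{K}$ for the empty arrangement). *)

(* Defs.v *)
From HB Require Import structures.
From mathcomp Require Import all_boot all_order all_algebra.
Unset Strict Implicit. Unset Printing Implicit Defensive.
Import GRing.Theory.
Local Open Scope ring_scope.

(* An arrangement is represented by a finite index type [X] and an injective
   family [h : X -> {vspace 'rV[K]_l}] of subspaces; [U] is the ambient space
   (fullv for V = K^l, H0 for the restriction A'').  Codimensions are taken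
   relative to [U]. *)
Section OrlikSolomon.
Variables (K : fieldType) (l : nat) (U : {vspace 'rV[K]_l}).
Variables (X : finType) (h : X -> {vspace 'rV[K]_l}).

Definition cap_tuple (s : seq X) : {vspace 'rV[K]_l} :=
  (\big[capv/U]_(x <- s) h x)%VS.

Definition dependent_tuple (s : seq X) : bool :=
  (\dim U - \dim (cap_tuple s) < size s)%N.

(* exterior algebra E on generators e_x (x : X), basis indexed by subsets *)
Definition ext := {ffun {set X} -> K^o}.

Definition ltX (x y : X) : bool := (enum_rank x < enum_rank y)%N.

(* sign of e_S e_T = sgn S T * e_(S \cup T) for disjoint S, T (elements of
   S, T listed increasingly w.r.t. the order ltX) *)
Definition ext_sgn (S T : {set X}) : K :=
  (-1) ^+ #|[set p : X * X | (p.1 \in S) && (p.2 \in T) && ltX p.2 p.1]|.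

Definition ext_basis (S : {set X}) : ext := [ffun T => (T == S)%:R].
Definition ext_one : ext := ext_basis set0.
Definition ext_gen (x : X) : ext := ext_basis [set x].

Definition ext_mul (f g : ext) : ext :=
  [ffun W => \sum_(S : {set X}) \sum_(T : {set X} |
                 [disjoint S & T] && (S :|: T == W))
               ext_sgn S T * f S * g T].

Definition ext_mon (s : seq X) : ext := foldr (fun x m => ext_mul (ext_gen x) m) ext_one s.

Definition ext_bd (s : seq X) : ext :=
  \sum_(k < size s) (-1) ^+ k *: ext_mon (take k s ++ drop k.+1 s).

Definition in_OS_ideal (x : ext) : Prop :=
  exists gs : seq (ext * seq X * ext),
    all (fun t => dependent_tuple t.1.2) gs /\
    x = \sum_(t <- gs) ext_mul (ext_mul t.1.1 (ext_bd t.1.2)) t.2.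

(* kappa for a partition P = (sigma_1, ..., sigma_t) (a seq of blocks).
   The tensor product [sigma_1] (x) ... (x) [sigma_t] has basis the pure
   tensors b_1 (x) ... (x) b_t, b_i \in {1} \cup {a_H | H \in sigma_i};
   such a basis vector is encoded by c : 'I_t -> option X (None = 1). *)
Definition choice_valid (P : seq {set X}) (c : {ffun 'I_(size P) -> option X}) : bool :=
  [forall i, if c i is Some x then x \in nth set0 P i else true].

Definition kappa_mon (P : seq {set X}) (c : {ffun 'I_(size P) -> option X}) : ext :=
  \big[ext_mul/ext_one]_(i < size P) (if c i is Some x then ext_gen x else ext_one).

Definition kappa (P : seq {set X}) (lam : {ffun 'I_(size P) -> option X} -> K) : ext :=
  \sum_(c | choice_valid P c) lam c *: kappa_mon P c.

(* kappa : [sigma_1] (x) ... (x) [sigma_t] -> A = E/I is bijective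
   (it is linear and degree preserving, hence then an isomorphism of graded
   vector spaces): injective modulo I and surjective modulo I. *)
Definition kappa_iso (P : seq {set X}) : Prop :=
  (forall lam, in_OS_ideal (kappa P lam) -> forall c, choice_valid P c -> lam c = 0)
  /\ (forall x : ext, exists lam, in_OS_ideal (x - kappa P lam)).

End OrlikSolomon.

Definition is_partition {X : finType} (P : seq {set X}) : Prop :=
  all (fun B => B != set0) P /\
  (forall i j, (i < j < size P)%N -> [disjoint nth set0 P i & nth set0 P j]) /\
  \bigcup_(B <- P) B = [set: X].

Definition idx' {X : finType} (x0 : X) : finType := {x : X | x != x0}.
Definition idx'' {X : finType} (p1 : {set X}) : finType := {x : X | x \notin p1}.

Definition fam' {K : fieldType} {l} {X : finType} (h : X -> {vspace 'rV[K]_l}) (x0 : X)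
  (y : idx' x0) : {vspace 'rV[K]_l} := h (val y).
(* A'' = {H \cap H0}, indexed (via the bijection R) by A \ pi_1 *)
Definition fam'' {K : fieldType} {l} {X : finType} (h : X -> {vspace 'rV[K]_l}) (x0 : X)
  (p1 : {set X}) (y : idx'' p1) : {vspace 'rV[K]_l} := (h (val y) :&: h x0)%VS.

Definition part' {X : finType} (x0 : X) (P : seq {set X}) : seq {set idx' x0} :=
  [seq B' <- [seq [set y : idx' x0 | val y \in B] | B : {set X} <- P] | B' != set0].
Definition part'' {X : finType} (p1 : {set X}) (P : seq {set X}) : seq {set idx'' p1} :=
  [seq [set y : idx'' p1 | val y \in B] | B : {set X} <- behead P].

Definition restriction_bijective {K : fieldType} {l} {X : finType} (h : X -> {vspace 'rV[K]_l})
  (x0 : X) (p1 : {set X}) : Prop :=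
  {in [pred x | x \notin p1] &, injective (fun x => (h x :&: h x0)%VS)} /\
  (forall x, x != x0 -> exists2 y, y \notin p1 & (h x :&: h x0 = h y :&: h x0)%VS).
Arguments cap_tuple {K l} U {X} h s.
Arguments dependent_tuple {K l} U {X} h s.
Arguments in_OS_ideal {K l} U {X} h x.
Arguments kappa_iso {K l} U {X} h P.

(* Main.v *)
(* The exact sequence [0 -> A(A') -> A(A) -> A(A'') -> 0] is compared with the corresponding
   decomposition of the tensor products, in which pure tensors of [pi] involving [a_{H_0}] match
   those of [pi''] and the others match those of [pi']; the theorem is then a short five lemma.

   The second map is the residue [f |-> rho (d f)], where [d] is the contraction by [e_{H_0}]
   and [rho] sends [e_H] to [e_{R(H)}] and [e_{H_0}] to [0].  Injectivity of the first map avoids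
   broken circuits: the ideal [I] is graded by degree and by flats and is stable under the
   derivation [D], and if all monomials of [f] have flat [Z] contained in [H_y], then
   [e_y f] is a combination of dependent monomials, so [f = D (e_y f) + e_y D f] reduces
   the claim to [D f], which has lower degree.

   Linear maps out of the exterior algebra are obtained from alternating functions on sequences
   of generators. *)
Require Import Defs.
From HB Require Import structures.
From mathcomp Require Import all_boot all_order all_algebra.
Import GRing.Theory.

(** * The exterior algebra *)

Section Exterior.
Set Implicit Arguments.
Unset Strict Implicit.
Local Open Scope ring_scope.
Variables (K : fieldType) (X : finType).
Local Notation E := (ext K X).
Implicit Types (f g : E) (S T W : {set X}) (x y : X) (s t r : seq X).

Local Notation "f ** g" := (ext_mul K X f g) (at level 40, left associativity).
Local Notation eb := (ext_basis K X).
Local Notation e_ := (ext_gen K X).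
Local Notation mon := (ext_mon K X).
Local Notation sgn := (ext_sgn K X).

Lemma ext_mul_linearr f a g1 g2 : f ** (a *: g1 + g2) = a *: (f ** g1) + f ** g2.
Proof.
apply/ffunP=> W; rewrite !ffunE scaler_sumr -big_split; apply: eq_bigr => S _.
rewrite scaler_sumr -big_split; apply: eq_bigr => T _ /=.
by rewrite !ffunE mulrDr /GRing.scale /= mulrCA.
Qed.

Lemma ext_mul_linearl g a f1 f2 : (a *: f1 + f2) ** g = a *: (f1 ** g) + f2 ** g.
Proof.
apply/ffunP=> W; rewrite !ffunE scaler_sumr -big_split; apply: eq_bigr => S _.
rewrite scaler_sumr -big_split; apply: eq_bigr => T _ /=.
rewrite !ffunE mulrDr mulrDl /GRing.scale /=; congr (_ + _).
by rewrite !mulrA; congr (_ * _ * _); rewrite mulrC.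
Qed.

HB.instance Definition _ f := GRing.isLinear.Build K E E _ (ext_mul K X f)
  (fun a => ext_mul_linearr f a).

(** Multiplication with its arguments swapped, so that linearity in the left factor can also be
    registered as an instance. *)
Definition ext_mulr g f := f ** g.

HB.instance Definition _ g := GRing.isLinear.Build K E E _ (ext_mulr g)
  (fun a => ext_mul_linearl g a).

Lemma ext_mulDr f g1 g2 : f ** (g1 + g2) = f ** g1 + f ** g2.
Proof. exact: linearD. Qed.
Lemma ext_mulNr f g : f ** - g = - (f ** g).
Proof. exact: linearN. Qed.
Lemma ext_mulBr f g1 g2 : f ** (g1 - g2) = f ** g1 - f ** g2.
Proof. exact: linearB. Qed.
Lemma ext_mulZr f a g : f ** (a *: g) = a *: (f ** g).
Proof. exact: linearZ_LR. Qed.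
Lemma ext_mul0r f : f ** 0 = 0.
Proof. exact: linear0. Qed.
Lemma ext_mulDl f1 f2 g : (f1 + f2) ** g = f1 ** g + f2 ** g.
Proof. exact: (linearD (ext_mulr g)). Qed.
Lemma ext_mulNl f g : (- f) ** g = - (f ** g).
Proof. exact: (linearN (ext_mulr g)). Qed.
Lemma ext_mulBl f1 f2 g : (f1 - f2) ** g = f1 ** g - f2 ** g.
Proof. exact: (linearB (ext_mulr g)). Qed.
Lemma ext_mulZl a f g : (a *: f) ** g = a *: (f ** g).
Proof. exact: (linearZ_LR (ext_mulr g)). Qed.
Lemma ext_mul0l g : 0 ** g = 0.
Proof. exact: (linear0 (ext_mulr g)). Qed.
Lemma ext_mul_suml I (r : seq I) (P : pred I) (F : I -> E) g :
  (\sum_(i <- r | P i) F i) ** g = \sum_(i <- r | P i) F i ** g.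
Proof. exact: (linear_sum (ext_mulr g)). Qed.

Lemma ext_mul_sumr I (r : seq I) (P : pred I) (F : I -> E) f :
  f ** (\sum_(i <- r | P i) F i) = \sum_(i <- r | P i) f ** F i.
Proof. exact: linear_sum. Qed.

Lemma ext_basis_sum f : f = \sum_S f S *: eb S.
Proof.
apply/ffunP=> T; rewrite sum_ffunE (bigD1 T) //= big1 ?addr0 => [|S nST].
  by rewrite !ffunE eqxx /GRing.scale /= mulr1.
by rewrite !ffunE eq_sym (negPf nST) scaler0.
Qed.

Lemma ext_basis_mul S T :
  eb S ** eb T = if [disjoint S & T] then sgn S T *: eb (S :|: T) else 0.
Proof.
apply/ffunP=> W; rewrite !ffunE (bigD1 S) //= [X in _ + X]big1 ?addr0; last first.
  by move=> S' nS; apply: big1 => T' _; rewrite !ffunE (negPf nS) mulr0 mul0r.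
case: ifP => dST; last first.
  rewrite [RHS]ffunE big1 // => T' /andP[dST' _]; rewrite !ffunE.
  by case: (eqVneq T' T) dST' => [->|_ _]; rewrite ?dST ?mulr0.
rewrite !ffunE [W == _]eq_sym; case: (eqVneq (S :|: T) W) => [<-|neW].
  rewrite (bigD1 T) /= ?dST ?eqxx // big1 ?addr0 => [|T' /andP[_ nT]].
    by rewrite !ffunE !eqxx /GRing.scale /= !mulr1.
  by rewrite !ffunE (negPf nT) mulr0.
rewrite scaler0 big1 // => T' /andP[_ /eqP eW].
by rewrite !ffunE; case: (eqVneq T' T) eW => [-> eW|_ _]; rewrite ?mulr0 //; rewrite eW eqxx in neW.
Qed.

Lemma ext_sgnUl S T W : [disjoint S & T] -> sgn (S :|: T) W = sgn S W * sgn T W.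
Proof.
move=> dST; rewrite /ext_sgn -exprD; congr (_ ^+ _).
rewrite -cardsUI [X in (_ + X)%N]eq_card0 ?addn0.
  apply: eq_card => p; rewrite !inE.
  by case: (p.1 \in S); case: (p.1 \in T); case: (p.2 \in W); case: (ltX _ _ _).
move=> p; rewrite !inE; apply/negP=> /andP[/andP[/andP[pS _] _] /andP[/andP[pT _] _]].
by have /pred0P/(_ p.1)/= := dST; rewrite pS pT.
Qed.

Lemma ext_sgnUr S T W : [disjoint S & T] -> sgn W (S :|: T) = sgn W S * sgn W T.
Proof.
move=> dST; rewrite /ext_sgn -exprD; congr (_ ^+ _).
rewrite -cardsUI [X in (_ + X)%N]eq_card0 ?addn0.
  apply: eq_card => p; rewrite !inE.
  by case: (p.2 \in S); case: (p.2 \in T); case: (p.1 \in W); case: (ltX _ _ _).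
move=> p; rewrite !inE; apply/negP=> /andP[/andP[/andP[_ pS] _] /andP[/andP[_ pT] _]].
by have /pred0P/(_ p.2)/= := dST; rewrite pS pT.
Qed.

Lemma disjointU_l S T W : [disjoint S :|: T & W] = [disjoint S & W] && [disjoint T & W].
Proof. by rewrite -!setI_eq0 setIUl setU_eq0. Qed.

Lemma disjointU_r S T W : [disjoint W & S :|: T] = [disjoint W & S] && [disjoint W & T].
Proof. by rewrite -!setI_eq0 setIUr setU_eq0. Qed.

(** Since [sgn] is multiplicative over disjoint unions in each argument, both sides carry the sign
    [sgn S T * sgn S W * sgn T W]. *)
Lemma ext_basis_mulA S T W : eb S ** (eb T ** eb W) = eb S ** eb T ** eb W.
Proof.
rewrite !ext_basis_mul; case: ifP => dTW; case: ifP => dST;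
  rewrite ?ext_mul0r ?ext_mul0l ?ext_mulZr ?ext_mulZl //= ?ext_basis_mul
    ?disjointU_l ?disjointU_r ?dTW ?dST ?andbF /= ?scaler0 //.
case: ifP => dSW; rewrite ?scaler0 //.
by rewrite !scalerA ext_sgnUl // ext_sgnUr // setUA mulrC mulrA.
Qed.

Lemma ext_mulA f g (h : E) : f ** (g ** h) = f ** g ** h.
Proof.
rewrite (ext_basis_sum f) !ext_mul_suml; apply: eq_bigr => S _.
rewrite !ext_mulZl; congr (_ *: _).
rewrite (ext_basis_sum g) !ext_mul_sumr !ext_mul_suml ext_mul_sumr; apply: eq_bigr => T _.
rewrite !ext_mulZr !ext_mulZl ext_mulZr; congr (_ *: _).
rewrite (ext_basis_sum h) !ext_mul_sumr; apply: eq_bigr => W _.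
by rewrite !ext_mulZr ext_basis_mulA.
Qed.

Lemma ext_mul1l f : ext_one K X ** f = f.
Proof.
rewrite {1}(ext_basis_sum f) ext_mul_sumr [RHS]ext_basis_sum; apply: eq_bigr => S _.
rewrite ext_mulZr ext_basis_mul -setI_eq0 set0I eqxx set0U /ext_sgn eq_card0 ?scale1r //.
by move=> p; rewrite !inE.
Qed.

Lemma ext_mul1r f : f ** ext_one K X = f.
Proof.
rewrite {1}(ext_basis_sum f) ext_mul_suml [RHS]ext_basis_sum; apply: eq_bigr => S _.
rewrite ext_mulZl ext_basis_mul -setI_eq0 setI0 eqxx setU0 /ext_sgn eq_card0 ?scale1r //.
by move=> p; rewrite !inE andbF.
Qed.

Lemma ext_genC x y : e_ x ** e_ y = - (e_ y ** e_ x).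
Proof.
have [<-|nxy] := eqVneq x y.
  by rewrite ext_basis_mul disjoints1 inE eqxx oppr0.
rewrite !ext_basis_mul !disjoints1 !inE nxy eq_sym nxy setUC -scaleNr; congr (_ *: _).
have E1 u v : sgn [set u] [set v] = (-1) ^+ ltX X v u.
  rewrite /ext_sgn; congr (_ ^+ _); case l_vu: (ltX X v u).
    rewrite (@eq_card _ _ (mem [set (u, v)])) ?cards1 // => -[a b]; rewrite !inE /= -pair_eqE /=.
    by case: eqP => [->|//]; case: eqP => [->|//]; rewrite l_vu.
  rewrite eq_card0 // => -[a b]; rewrite !inE /=.
  by case: eqP => [->|//]; case: eqP => [->|//]; rewrite l_vu.
(* For distinct [x] and [y] exactly one of the two orders is an inversion, so the two signs are
   opposite. *)
rewrite !E1 /ltX; have: enum_rank x != enum_rank y by rewrite (inj_eq enum_rank_inj).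
rewrite -val_eqE /=; case: ltngtP => // _ _; by rewrite ?opprK ?expr0 ?expr1 ?opprK.
Qed.

Lemma ext_gen_sqr x : e_ x ** e_ x = 0.
Proof. by rewrite ext_basis_mul disjoints1 inE eqxx. Qed.

Lemma ext_mon_cons x s : mon (x :: s) = e_ x ** mon s.
Proof. by []. Qed.

Lemma ext_mon_cat s t : mon (s ++ t) = mon s ** mon t.
Proof.
by elim: s => [|x s IHs]; rewrite ?ext_mul1l //= -ext_mulA -IHs.
Qed.

(** * Alternating functions and the universal property of the exterior algebra *)

Section Alternating.
Variable V : lmodType K.
Implicit Type F : seq X -> V.

(** The vanishing clause is separate because in characteristic 2 it does not follow from
    antisymmetry. *)
Definition alternating F :=
  (forall r x y s, F (r ++ x :: y :: s) = - F (r ++ y :: x :: s)) /\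
  (forall r x s, F (r ++ x :: x :: s) = 0).

Lemma alternating_move F r x s t : alternating F ->
  F (r ++ x :: s ++ t) = (-1) ^+ size s *: F (r ++ s ++ x :: t).
Proof.
case=> altF _; elim: s r => [|y s IHs] r; first by rewrite scale1r.
by rewrite /= altF -cat_rcons IHs cat_rcons exprS mulN1r scaleNr.
Qed.

Lemma alternating_cons F x : alternating F -> alternating (F \o cons x).
Proof. by case=> F1 F2; split=> r; [exact: (F1 (x :: r))|exact: (F2 (x :: r))]. Qed.

(** The linear extension of [F] from increasing sequences: [enum S] lists [S] in the order [ltX]
    that defines the signs of the product. *)
Definition alt_lift F f : V := \sum_S f S *: F (enum S).

Lemma alt_lift_linear F : linear (alt_lift F).
Proof.
move=> a f g; rewrite /alt_lift scaler_sumr -big_split; apply: eq_bigr => S _ /=.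
by rewrite !ffunE scalerDl scalerA.
Qed.

HB.instance Definition _ F := GRing.isLinear.Build K E V _ (alt_lift F)
  (fun a => alt_lift_linear F a).

Lemma alt_lift_basis F S : alt_lift F (eb S) = F (enum S).
Proof.
rewrite /alt_lift (bigD1 S) //= big1 ?addr0 => [|T nTS].
  by rewrite ffunE eqxx scale1r.
by rewrite ffunE (negPf nTS) scale0r.
Qed.

Lemma enum_rank_index x : enum_rank x = index x (enum X) :> nat.
Proof.
rewrite -{2}(enum_rankK x) (enum_val_nth x) index_uniq ?enum_uniq //.
by rewrite -cardE.
Qed.

(** Sorting [x] into [enum S] costs one transposition for each element of [S] preceding [x], and
    these are the inversions counted by [ext_sgn]. If [x] is already in [S], moving it next to its
    copy gives zero on both sides. *)
Lemma alt_lift_gen_mul F x f : alternating F ->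
  alt_lift F (e_ x ** f) = alt_lift (F \o cons x) f.
Proof.
move=> altF; rewrite (ext_basis_sum f) ext_mul_sumr !linear_sum; apply: eq_bigr => S _.
rewrite ext_mulZr !linearZ_LR; congr (_ *: _).
rewrite /= ext_basis_mul alt_lift_basis disjoints1 /=.
have enX : x \in enum X by rewrite mem_enum.
(* Cutting the enumeration of [X] at [x] cuts every [enum T] into the elements before [x] and the
   rest. *)
have [e1 [e2 def_e]] : exists e1 e2, enum X = e1 ++ x :: e2.
  by case/splitPr: enX => e1 e2; exists e1, e2.
have Ue : uniq (e1 ++ x :: e2) by rewrite -def_e enum_uniq.
have enE T : enum T = filter (mem T) e1 ++ filter (mem T) (x :: e2).
  by rewrite -filter_cat -def_e enumT.
have [xS|xS] /= := boolP (x \in S).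
  rewrite linear0 enE /= xS -[x :: _ ++ _]/([::] ++ x :: _ ++ _) alternating_move //=.
  by rewrite (proj2 altF) scaler0.
have xe1 : x \notin e1 by move: Ue; rewrite cat_uniq /= => /and3P[_ /norP[]].
have xe2 : x \notin e2 by move: Ue; rewrite cat_uniq /= => /and4P[_ _].
rewrite linearZ_LR /= alt_lift_basis !enE /= !inE eqxx /= (negPf xS).
rewrite -[x :: _ ++ _]/([::] ++ x :: _ ++ _) alternating_move //=.
have eqf e : x \notin e -> [seq y <- e | mem (x |: S) y] = [seq y <- e | mem S y].
  move=> xe; apply: eq_in_filter => y ye; rewrite /= !inE.
  by case: eqP xe => // <-; rewrite ye.
rewrite !eqf //; congr (_ *: _); rewrite /ext_sgn; congr (_ ^+ _).
have ltE y : ltX X y x = (y \in e1).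
  rewrite /ltX !enum_rank_index def_e !index_cat (negPf xe1) /= eqxx addn0.
  by case: ifP => y1; rewrite ?index_mem // ltnNge leq_addr.
transitivity #|[set y in S | y \in e1]|.
  rewrite -[RHS](card_imset _ (_ : injective (pair x))); last by move=> ? ? [].
  apply: eq_card => -[u v]; rewrite !inE /=; apply/andP/imsetP => [[/andP[/eqP-> vS]]|[w]].
    by rewrite ltE => ve; exists v; rewrite // inE vS.
  by rewrite inE => /andP[wS we] [-> ->]; rewrite eqxx wS ltE.
rewrite cardE; apply/perm_size/uniq_perm.
- exact: enum_uniq.
- by apply: filter_uniq; move: Ue; rewrite cat_uniq => /and3P[].
by move=> y; rewrite mem_enum mem_filter inE.
Qed.

Lemma alt_lift_mon F s : alternating F -> alt_lift F (mon s) = F s.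
Proof.
elim: s F => [|x s IHs] F altF; first by rewrite alt_lift_basis enum_set0.
by rewrite ext_mon_cons alt_lift_gen_mul // IHs //; apply: alternating_cons.
Qed.
End Alternating.
End Exterior.

(** * Derivations and projections of the exterior algebra *)

Section ExteriorMaps.
Set Implicit Arguments.
Unset Strict Implicit.
Local Open Scope ring_scope.
Variables (K : fieldType) (X : finType).
Local Notation E := (ext K X).
Implicit Types (f g : E) (S T W : {set X}) (x y : X) (s t r : seq X).
Local Notation "f ** g" := (ext_mul K _ f g) (at level 40, left associativity).
Local Notation e_ := (ext_gen K X).
Local Notation mon := (ext_mon K X).

Lemma ext_mon_alternating : alternating mon.
Proof.
split=> r; [move=> x y s|move=> x s]; rewrite !ext_mon_cat /= !ext_mulA.
  by rewrite -[mon r ** _ ** _]ext_mulA ext_genC ext_mulNr ext_mulNl ext_mulA.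
by rewrite -[mon r ** _ ** _]ext_mulA ext_gen_sqr ext_mul0r ext_mul0l.
Qed.

Lemma ext_mon_split x s : x \in s ->
  exists t k, perm_eq s (x :: t) /\ mon s = (-1) ^+ k *: mon (x :: t).
Proof.
case/splitPr=> s1 s2; exists (s1 ++ s2), (size s1); split.
  by rewrite perm_catC /= perm_cons perm_catC.
have := alternating_move [::] x s1 s2 ext_mon_alternating; rewrite /= => ->.
by rewrite signrZK.
Qed.

Lemma ext_mon_nuniq s : ~~ uniq s -> mon s = 0.
Proof.
elim: s => //= x s IHs; rewrite negb_and negbK => /orP[xs|/IHs->]; last by rewrite ext_mul0r.
have [t [k [_ ->]]] := ext_mon_split xs.
by rewrite ext_mulZr /= ext_mulA ext_gen_sqr ext_mul0l scaler0.
Qed.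

Lemma ext_mon_basis s : uniq s -> exists k, mon s = (-1) ^+ k *: ext_basis K X [set:: s].
Proof.
elim: s => [_|x s IHs /= /andP[xs /IHs[k ->]]].
  by exists 0%N; rewrite scale1r; congr ext_basis; apply/setP=> x; rewrite !inE.
rewrite ext_mulZr ext_basis_mul disjoints1 inE xs /ext_sgn scalerA -exprD.
by eexists; congr (_ *: ext_basis _ _ _); apply/setP=> y; rewrite !inE.
Qed.

(** Each basis vector [ext_basis S] is a sign times the monomial of [enum S], so linear statements
    need only be checked on monomials. *)
Lemma ext_mon_ind (P : E -> Prop) :
  (forall a f g, P f -> P g -> P (a *: f + g)) -> (forall s, P (mon s)) -> forall f, P f.
Proof.
move=> Plin Pmon f; have P0 : P 0.
  by have := Plin (-1) _ _ (Pmon [::]) (Pmon [::]); rewrite scaleN1r addNr.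
rewrite (ext_basis_sum f); apply: big_rec => // S g _ Pg; apply: (Plin) Pg.
have [k] := ext_mon_basis (enum_uniq S); rewrite set_enum => /(canLR (signrZK k)).
by move=> <-; rewrite -[_ *: _]addr0; apply: Plin.
Qed.

(** The antiderivation of degree -1 that sends the generator of [x] to [w x]. Constant [w = 1] gives
    the boundary, and the indicator function of [x0] gives the contraction by that generator. *)
Fixpoint der_seq (w : X -> K) s : E :=
  if s is x :: s' then w x *: mon s' - e_ x ** der_seq w s' else 0.

Lemma der_seq_alternating w : alternating (der_seq w).
Proof.
split.
  elim=> [|z r IHr] x y s /=.
    rewrite !ext_mulBr !ext_mulZr !ext_mulA [e_ x ** e_ y]ext_genC ext_mulNl.
    by rewrite !opprB addrA.
  have /= -> := (proj1 ext_mon_alternating) r x y s.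
  by rewrite IHr ext_mulNr scalerN opprK opprB addrC.
elim=> [|z r IHr] x s /=.
  by rewrite ext_mulBr ext_mulZr !ext_mulA ext_gen_sqr ext_mul0l subr0 subrr.
by rewrite IHr (proj2 ext_mon_alternating) ext_mul0r scaler0 subr0.
Qed.

Definition ext_der w : E -> E := alt_lift (der_seq w).
HB.instance Definition _ w := GRing.Linear.copy (ext_der w) (alt_lift (der_seq w)).

Lemma ext_der_mon w s : ext_der w (mon s) = der_seq w s.
Proof. exact: alt_lift_mon (der_seq_alternating w). Qed.

Lemma ext_der_gen_mul w x f : ext_der w (e_ x ** f) = w x *: f - e_ x ** ext_der w f.
Proof.
elim/ext_mon_ind: f => [a f g Ef Eg|s]; last by rewrite -ext_mon_cons !ext_der_mon.
by rewrite ext_mulDr ext_mulZr !linearP /= Ef Eg scalerDr addrACA.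
Qed.

Lemma ext_der1 w : ext_der w (ext_one K X) = 0.
Proof. exact: (ext_der_mon w [::]). Qed.

Lemma ext_der_mon_mul w r f :
  ext_der w (mon r ** f) = ext_der w (mon r) ** f + (-1) ^+ size r *: (mon r ** ext_der w f).
Proof.
elim: r => [|x r IHr]; first by rewrite !ext_mul1l ext_der1 ext_mul0l scale1r add0r.
rewrite ext_mon_cons -ext_mulA !ext_der_gen_mul IHr /= ext_mulBl ext_mulZl ext_mulDr ext_mulZr.
by rewrite !ext_mulA opprD addrA exprS mulN1r scaleNr.
Qed.

Lemma ext_der_sqr w f : ext_der w (ext_der w f) = 0.
Proof.
elim/ext_mon_ind: f => [a f g Ef Eg|s].
  by rewrite !linearP /= Ef Eg scaler0 addr0.
elim: s => [|x s IHs]; first by rewrite ext_der1 linear0.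
by rewrite ext_der_gen_mul linearB linearZ_LR /= ext_der_gen_mul IHs ext_mul0r subr0 subrr.
Qed.

Lemma ext_der_anticomm w v f : ext_der w (ext_der v f) = - ext_der v (ext_der w f).
Proof.
elim/ext_mon_ind: f => [a f g Ef Eg|s].
  by rewrite !linearP /= Ef Eg.
elim: s => [|x s IHs]; first by rewrite !ext_der1 !linear0.
rewrite ext_mon_cons; move: (mon s) IHs => m IHs.
rewrite !ext_der_gen_mul !(linearB (ext_der _)) !(linearZ_LR (ext_der _)) /=.
by rewrite !ext_der_gen_mul IHs ext_mulNr !opprB addrA.
Qed.

(** Unfolding the Leibniz rule along [s], the derivative of the [k]-th factor has crossed [k]
    generators, whence the sign. The relations thus become values of a derivation. *)
Lemma ext_bd_der s : ext_bd K X s = ext_der (fun=> 1) (mon s).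
Proof.
rewrite ext_der_mon /ext_bd; elim: s => [|x s IHs]; first by rewrite big_ord0.
rewrite big_ord_recl /= expr0 drop0 -IHs ext_mul_sumr -sumrN; congr (_ + _).
by apply: eq_bigr => i _; rewrite /bump /= add1n exprS mulN1r scaleNr ext_mulZr.
Qed.

Section Selection.
Variable phi : seq X -> bool.

(** Extends to the projection onto the span of the monomials that satisfy [phi], provided [phi]
    ignores the order of the factors. It is used below for degrees and for flats. *)
Definition sel_seq s : E := if phi s then mon s else 0.
Definition ext_sel : E -> E := alt_lift sel_seq.
HB.instance Definition _ := GRing.Linear.copy ext_sel (alt_lift sel_seq).

Hypothesis phi_perm : forall s t, perm_eq s t -> phi s = phi t.

Lemma sel_seq_alternating : alternating sel_seq.
Proof.
rewrite /sel_seq; split=> [r x y s|r x s]; last by rewrite (proj2 ext_mon_alternating) if_same.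
rewrite (proj1 ext_mon_alternating) (phi_perm (t := r ++ y :: x :: s)); last first.
  by rewrite perm_cat2l -(cat1s x) -(cat1s y) perm_catCA.
by case: ifP; rewrite ?oppr0.
Qed.

Lemma ext_sel_mon s : ext_sel (mon s) = if phi s then mon s else 0.
Proof. exact: alt_lift_mon sel_seq_alternating. Qed.

End Selection.

End ExteriorMaps.

Arguments ext_sel_mon {K X phi} phi_perm s.

(** * Algebra homomorphisms induced by maps of generators *)

Section ExteriorHom.
Set Implicit Arguments.
Unset Strict Implicit.
Local Open Scope ring_scope.
Variables (K : fieldType) (X Y : finType) (u : X -> option Y).
Local Notation "f ** g" := (ext_mul K _ f g) (at level 40, left associativity).

(** [None] encodes a generator sent to zero; this covers both the image of [x0] under the
    restriction and the augmentation. *)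
Definition ogen y : ext K Y := if y is Some z then ext_gen K Y z else 0.
Definition hom_seq (s : seq X) : ext K Y :=
  foldr (fun x m => ogen (u x) ** m) (ext_one K Y) s.

Lemma ogenC x y : ogen x ** ogen y = - (ogen y ** ogen x).
Proof.
by case: x y => [x|] [y|] /=; rewrite ?ext_mul0r ?ext_mul0l ?oppr0 //; exact: ext_genC.
Qed.

Lemma ogen_sqr x : ogen x ** ogen x = 0.
Proof. by case: x => [x|] /=; rewrite ?ext_mul0r //; exact: ext_gen_sqr. Qed.

Lemma hom_seq_alternating : alternating hom_seq.
Proof.
split; elim=> [|z r IHr].
- by move=> x y s; rewrite /= !ext_mulA ogenC ext_mulNl.
- by move=> x y s; rewrite /= IHr ext_mulNr.
- by move=> x s; rewrite /= ext_mulA ogen_sqr ext_mul0l.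
- by move=> x s; rewrite /= IHr ext_mul0r.
Qed.

Definition ext_hom : ext K X -> ext K Y := alt_lift hom_seq.
HB.instance Definition _ := GRing.Linear.copy ext_hom (alt_lift hom_seq).

Lemma ext_hom_mon s : ext_hom (ext_mon K X s) = hom_seq s.
Proof. exact: alt_lift_mon hom_seq_alternating. Qed.

Lemma ext_hom_gen_mul x f : ext_hom (ext_gen K X x ** f) = ogen (u x) ** ext_hom f.
Proof.
elim/ext_mon_ind: f => [a f g Ef Eg|s]; last by rewrite -ext_mon_cons !ext_hom_mon.
by rewrite ext_mulDr ext_mulZr !linearP /= Ef Eg.
Qed.

Lemma ext_hom_mul f g : ext_hom (f ** g) = ext_hom f ** ext_hom g.
Proof.
elim/ext_mon_ind: f => [a f1 f2 E1 E2|s].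
  by rewrite ext_mulDl ext_mulZl !linearP /= E1 E2 ext_mulDl ext_mulZl.
elim: s => [|x s IHs]; first by rewrite ext_hom_mon !ext_mul1l.
by rewrite ext_mon_cons -ext_mulA !ext_hom_gen_mul IHs ext_mulA.
Qed.

Lemma ext_hom_mon_some (v : X -> Y) s : (forall x, x \in s -> u x = Some (v x)) ->
  ext_hom (ext_mon K X s) = ext_mon K Y (map v s).
Proof.
rewrite ext_hom_mon; elim: s => //= x s IHs uv.
by rewrite uv ?mem_head // IHs // => y ys; apply: uv; rewrite inE ys orbT.
Qed.

End ExteriorHom.

(** * The Orlik-Solomon ideal *)

Section OSIdeal.
Set Implicit Arguments.
Unset Strict Implicit.
Local Open Scope ring_scope.
Variables (K : fieldType) (l : nat) (U : {vspace 'rV[K]_l}).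
Variables (X : finType) (h : X -> {vspace 'rV[K]_l}).
Local Notation E := (ext K X).
Local Notation I := (in_OS_ideal U h).
Local Notation dep := (dependent_tuple U h).
Local Notation cap := (cap_tuple U h).
Implicit Types (f g : E) (x y : X) (s t r : seq X).
Local Notation "f ** g" := (ext_mul K _ f g) (at level 40, left associativity).
Local Notation e_ := (ext_gen K X).
Local Notation mon := (ext_mon K X).
Local Notation D := (@ext_der K X (fun=> 1)).

Lemma ideal_lin a f g : I f -> I g -> I (a *: f + g).
Proof.
case=> [fs [dfs ->]] [gs [dgs ->]].
exists ([seq ((a *: p.1.1, p.1.2), p.2) | p <- fs] ++ gs).
rewrite all_cat all_map dgs andbT; split=> //.
rewrite big_cat big_map scaler_sumr; congr (_ + _); apply: eq_bigr => p _ /=.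
by rewrite !ext_mulZl.
Qed.

Lemma ideal0 : I 0.
Proof. by exists [::]; rewrite big_nil. Qed.

Lemma idealZ a f : I f -> I (a *: f).
Proof. by move=> If; rewrite -[_ *: _]addr0; apply: ideal_lin ideal0. Qed.

Lemma idealD f g : I f -> I g -> I (f + g).
Proof. by rewrite -{2}[f]scale1r; apply: ideal_lin. Qed.

Lemma idealN f : I f -> I (- f).
Proof. by rewrite -scaleN1r; apply: idealZ. Qed.

Lemma idealB f g : I f -> I g -> I (f - g).
Proof. by move=> If /idealN; apply: idealD. Qed.

Lemma ideal_sum J (r : seq J) (P : pred J) (F : J -> E) :
  (forall i, P i -> I (F i)) -> I (\sum_(i <- r | P i) F i).
Proof. by move=> IF; apply: big_ind => //; [exact: ideal0|exact: idealD]. Qed.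

Lemma ideal_mull f g : I g -> I (f ** g).
Proof.
case=> [gs [dgs ->]]; exists [seq ((f ** p.1.1, p.1.2), p.2) | p <- gs].
rewrite all_map; split=> //; rewrite big_map ext_mul_sumr; apply: eq_bigr => p _ /=.
by rewrite !ext_mulA.
Qed.

Lemma ideal_mulr f g : I f -> I (f ** g).
Proof.
case=> [gs [dgs ->]]; exists [seq (p.1, p.2 ** g) | p <- gs].
rewrite all_map; split=> //; rewrite big_map ext_mul_suml; apply: eq_bigr => p _ /=.
by rewrite !ext_mulA.
Qed.

Lemma ideal_gen s : dep s -> I (D (mon s)).
Proof.
move=> ds; rewrite -ext_bd_der; exists [:: (ext_one K X, s, ext_one K X)].
by rewrite /= ds big_seq1 /= ext_mul1l ext_mul1r.
Qed.

Lemma ext_mon_mul_gen s x : mon s ** e_ x = (-1) ^+ size s *: (e_ x ** mon s).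
Proof.
have := alternating_move [::] x s [::] (ext_mon_alternating K X).
by rewrite /= cats0 ext_mon_cat /= ext_mul1r => ->; rewrite signrZK.
Qed.

(* Differentiating [mon s ** e_ x = +- e_ x ** mon s] gives the rule for moving
   [e_ x] across [D (mon s)]. *)
Lemma ext_der_mon_mul_gen s x :
  D (mon s) ** e_ x = - ((-1) ^+ size s *: (e_ x ** D (mon s))).
Proof.
have Dx : D (e_ x) = ext_one K X.
  by rewrite -[e_ x]ext_mul1r ext_der_gen_mul ext_der1 ext_mul0r subr0 scale1r.
have := ext_der_mon_mul (fun=> 1) s (e_ x).
rewrite ext_mon_mul_gen Dx ext_mul1r (linearZ_LR (ext_der _)) /= ext_der_gen_mul scale1r.
by rewrite scalerBr [RHS]addrC => /addrI <-.
Qed.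

Lemma ext_der_mon_mulC s t :
  exists k, D (mon s) ** mon t = (-1) ^+ k *: (mon t ** D (mon s)).
Proof.
elim: t => [|x t [k IHt]]; first by exists 0%N; rewrite scale1r ext_mul1r ext_mul1l.
exists (1 + size s + k)%N; rewrite ext_mon_cons ext_mulA ext_der_mon_mul_gen.
rewrite ext_mulNl ext_mulZl -ext_mulA IHt ext_mulZr -ext_mulA.
by rewrite -scaleN1r !scalerA !exprD expr1 mulrA.
Qed.

(** Expanding both outer factors of a generator into monomials and moving the right one across
    [D (mon s)] up to sign leaves only the elements [mon r ** D (mon s)]. *)
Lemma ideal_ind (P : E -> Prop) :
  (forall a f g, P f -> P g -> P (a *: f + g)) ->
  (forall r s, dep s -> P (mon r ** D (mon s))) -> P 0 -> forall f, I f -> P f.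
Proof.
move=> Plin Pgen P0 _ [gs [dgs ->]].
have PD f g : P f -> P g -> P (f + g) by rewrite -{2}[f]scale1r; apply: Plin.
rewrite big_seq; apply: big_ind => // -[[f s] g] /(allP dgs) /= ds.
rewrite ext_bd_der; elim/ext_mon_ind: g => [a g1 g2 P1 P2|t].
  by rewrite ext_mulDr ext_mulZr; apply: Plin.
elim/ext_mon_ind: f => [a f1 f2 P1 P2|r].
  by rewrite !ext_mulDl !ext_mulZl; apply: Plin.
have [k] := ext_der_mon_mulC s t; rewrite -ext_mulA => ->.
rewrite ext_mulZr ext_mulA -ext_mon_cat -[_ *: _]addr0; apply: Plin => //.
exact: Pgen.
Qed.

(** By the Leibniz rule and [D (D f) = 0], the derivative of [mon r ** D (mon s)] is
    [D (mon r) ** D (mon s)]. *)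
Lemma ideal_der f : I f -> I (D f).
Proof.
move: f; apply: ideal_ind; [move=> a f g If Ig|move=> r s ds|rewrite linear0; exact: ideal0].
  by rewrite linearP; apply: ideal_lin.
rewrite ext_der_mon_mul ext_der_sqr ext_mul0r scaler0 addr0.
by apply: ideal_mull; apply: ideal_gen.
Qed.

Lemma mem_cap v s : (v \in cap s) = (v \in U) && all (fun x => v \in h x) s.
Proof.
rewrite /cap_tuple; elim: s => [|x s IHs]; first by rewrite big_nil andbT.
by rewrite big_cons memv_cap IHs /= andbCA.
Qed.

Lemma cap_perm s t : perm_eq s t -> cap s = cap t.
Proof. by move=> st; apply/vspaceP=> v; rewrite !mem_cap (perm_all _ st). Qed.

Lemma cap_sub s : (cap s <= U)%VS.
Proof. by apply/subvP=> v; rewrite mem_cap => /andP[]. Qed.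

Lemma dep_perm s t : perm_eq s t -> dep s = dep t.
Proof. by move=> st; rewrite /dependent_tuple (cap_perm st) (perm_size st). Qed.

(** Multiplying the relation of [x :: s] by [e_ x] gives back the monomial, because [e_ x] squares
    to zero. The empty tuple is never dependent. *)
Lemma dep_mon s : dep s -> I (mon s).
Proof.
case: s => [|x s] ds; first by move: ds; rewrite /dependent_tuple ltn0.
have := ideal_mull (e_ x) (ideal_gen ds).
by rewrite ext_der_gen_mul scale1r ext_mulBr ext_mulA ext_gen_sqr ext_mul0l subr0.
Qed.

Let del k s := take k s ++ drop k.+1 s.

(** If the deleted hyperplane does not contain the intersection of the others, deleting it lowers
    the codimension by at least one, while the length drops by exactly one. *)
Lemma dep_del x0 s k : (k < size s)%N -> dep s ->
  ~~ (cap (del k s) <= h (nth x0 s k))%VS -> dep (del k s).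
Proof.
move=> ks ds nsub.
have ps : perm_eq s (nth x0 s k :: del k s).
  by rewrite -{1}(cat_take_drop k s) (drop_nth x0 ks) perm_catC /= perm_cons perm_catC.
have ltd : (\dim (cap s) < \dim (cap (del k s)))%N.
  have scap : (cap s <= cap (del k s))%VS.
    by rewrite (cap_perm ps) /cap_tuple big_cons capvSr.
  rewrite (ltn_leqif (dimv_leqif_sup scap)); apply: contra nsub => sub.
  by apply: (subv_trans sub); rewrite (cap_perm ps) /cap_tuple big_cons capvSl.
move: ds; rewrite /dependent_tuple (perm_size ps) /= ltnS.
apply: leq_trans; apply: ltn_sub2l => //.
by apply: (leq_trans ltd); apply/dimvS/cap_sub.
Qed.

Lemma ext_mul_mon_der r s :
  mon r ** D (mon s) = \sum_(k < size s) (-1) ^+ k *: mon (r ++ del k s).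
Proof.
rewrite -ext_bd_der ext_mul_sumr; apply: eq_bigr => k _.
by rewrite ext_mulZr -ext_mon_cat.
Qed.

(** Modulo the ideal the projection acts on the generator as the scalar 0 or 1 given by [b]: a term
    on which [phi] differs from [b] contains a dependent monomial and so lies in the ideal
    itself. *)
Lemma ideal_sel_gen (phi : seq X -> bool) (b : bool) r s :
  (forall s t, perm_eq s t -> phi s = phi t) -> dep s ->
  (forall k, (k < size s)%N -> phi (r ++ del k s) = b \/ dep (del k s)) ->
  I (ext_sel phi (mon r ** D (mon s))).
Proof.
move=> phiP ds Hk; pose c : K := b%:R.
suff: I (ext_sel phi (mon r ** D (mon s)) - c *: (mon r ** D (mon s))).
  move=> Isub; rewrite -(subrK (c *: (mon r ** D (mon s))) (ext_sel _ _)).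
  by apply: idealD Isub _; apply: idealZ; apply: ideal_mull; apply: ideal_gen.
rewrite ext_mul_mon_der linear_sum scaler_sumr -sumrB; apply: ideal_sum => k _.
rewrite linearZ_LR /= ext_sel_mon // scalerA mulrC -scalerA -scalerBr; apply: idealZ.
have [->|dk] := Hk k (ltn_ord k).
  by rewrite /c; case: (b); rewrite ?scale1r ?scale0r subrr; exact: ideal0.
have Ik : I (mon (r ++ del k s)) by rewrite ext_mon_cat; apply: ideal_mull; apply: dep_mon.
by apply: idealB; [case: ifP => // _; exact: ideal0|exact: idealZ].
Qed.

(** The ideal is graded by degree, as all terms of a generator have the same length. *)
Lemma ideal_sel_size n f : I f -> I (ext_sel (fun s => size s == n) f).
Proof.
move: f; apply: ideal_ind; [move=> a f g If Ig|move=> r s ds|rewrite linear0; exact: ideal0].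
  by rewrite linearP; apply: ideal_lin.
apply: (@ideal_sel_gen _ (size r + (size s).-1 == n)%N) => // [t u /perm_size->//|k ks].
left; rewrite size_cat size_cat size_take size_drop ks; congr ((_ + _)%N == _).
by case: (size s) ks => // m; rewrite ltnS subSS => /subnKC.
Qed.

(** The ideal is graded by flats. A term of a generator either keeps the flat of [r ++ s] or, by
    [dep_del], still contains a dependent tuple. *)
Lemma ideal_sel_cap (psi : {vspace 'rV[K]_l} -> bool) f :
  I f -> I (ext_sel (fun s => psi (cap s)) f).
Proof.
move: f; apply: ideal_ind; [move=> a f g If Ig|move=> r s ds|rewrite linear0; exact: ideal0].
  by rewrite linearP; apply: ideal_lin.
apply: (@ideal_sel_gen _ (psi (cap (r ++ s)))) => // [t u /cap_perm->//|k ks].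
have x0 : X by case: s ks {ds}.
have [sub|nsub] := boolP (cap (del k s) <= h (nth x0 s k))%VS; last by right; apply: dep_del nsub.
left; congr psi; apply/vspaceP=> v; rewrite !mem_cap !all_cat andbCA [RHS]andbCA; congr (_ && _).
have ps : perm_eq s (nth x0 s k :: del k s).
  by rewrite -{1}(cat_take_drop k s) (drop_nth x0 ks) perm_catC /= perm_cons perm_catC.
rewrite (perm_all _ ps) /= -all_cat; have /subvP/(_ v) := sub; rewrite mem_cap.
by case: (v \in U) => //=; case: (all _ _) => [->//|]; rewrite ?andbF.
Qed.

End OSIdeal.

(** * Injectivity for subarrangements *)

Section Subarrangement.
Set Implicit Arguments.
Unset Strict Implicit.
Local Open Scope ring_scope.
Variables (K : fieldType) (l : nat) (X Y : finType).
Variables (h : X -> {vspace 'rV[K]_l}) (v : Y -> X).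
Hypothesis hyperplane_h : forall x, (\dim (h x)).+1 = l.
Let h' y := h (v y).
Local Notation "f ** g" := (ext_mul K _ f g) (at level 40, left associativity).
Local Notation D Z := (@ext_der K Z (fun=> 1)).
Local Notation iota := (@ext_hom K _ _ (fun y => Some (v y))).

Lemma hom_some_mon s : iota (ext_mon K Y s) = ext_mon K X (map v s).
Proof. exact: ext_hom_mon_some. Qed.

Lemma hom_some_der f : iota (D Y f) = D X (iota f).
Proof.
elim/ext_mon_ind: f => [a f g Ef Eg|s]; first by rewrite !linearP /= Ef Eg.
elim: s => [|y s IHs]; first by rewrite hom_some_mon !ext_der1 linear0.
rewrite ext_mon_cons ext_hom_gen_mul !ext_der_gen_mul (linearB (ext_hom _)) /=.
by rewrite (linearZ_LR (ext_hom _)) /= ext_hom_gen_mul IHs.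
Qed.

Lemma cap_sub_arr s : cap_tuple fullv h' s = cap_tuple fullv h (map v s).
Proof. by rewrite /cap_tuple big_map. Qed.

Lemma hom_some_ideal f : in_OS_ideal fullv h' f -> in_OS_ideal fullv h (iota f).
Proof.
move: f; apply: ideal_ind; [move=> a f g If Ig|move=> r s ds|rewrite linear0; exact: ideal0].
  by rewrite linearP; apply: ideal_lin.
rewrite ext_hom_mul hom_some_der !hom_some_mon; apply: ideal_mull; apply: ideal_gen.
by move: ds; rewrite /dependent_tuple size_map cap_sub_arr.
Qed.

Lemma hom_some_sel (phi : seq X -> bool) f :
  (forall s t, perm_eq s t -> phi s = phi t) ->
  iota (ext_sel (fun s => phi (map v s)) f) = ext_sel phi (iota f).
Proof.
move=> phiP; elim/ext_mon_ind: f => [a f g Ef Eg|s]; first by rewrite !linearP /= Ef Eg.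
rewrite hom_some_mon !ext_sel_mon //; last by move=> t u tu; apply/phiP/perm_map.
by case: ifP; rewrite ?linear0 // hom_some_mon.
Qed.

Lemma dimv_capv_hyperplane x (W : {vspace 'rV[K]_l}) : (\dim W <= (\dim (h x :&: W)).+1)%N.
Proof.
rewrite -(leq_add2l (\dim (h x))) addnS -addSn hyperplane_h -dimv_sum_cap.
rewrite leq_add2r; apply: leq_trans (dimvS (subvf _)) _.
by rewrite dimvf /dim /= mul1n.
Qed.

Lemma codim_cap_le (s : seq X) : (\dim {:'rV[K]_l} - \dim (cap_tuple fullv h s) <= size s)%N.
Proof.
elim: s => [|x s IHs]; first by rewrite /cap_tuple big_nil subnn.
rewrite /cap_tuple big_cons leq_subLR /= addnS -addSn.
move: IHs; rewrite leq_subLR => /leq_trans; apply; rewrite leq_add2r.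
exact: dimv_capv_hyperplane.
Qed.

Lemma dependent_size s : dependent_tuple fullv h s -> (1 < size s)%N.
Proof.
case: s => [|x [|y s]] //; rewrite /dependent_tuple /cap_tuple ?big_cons big_nil ?subnn //.
by rewrite capvf /= dimvf /dim /= mul1n
  ltnS leqn0 subn_eq0 -[X in (X <= _)%N](hyperplane_h x) !ltnn.
Qed.

(** Dependent tuples of hyperplanes have at least two entries, so every generator of the ideal has
    positive degree and vanishes when all [e_H] are sent to zero. *)
Lemma ideal_augmentation (Z : finType) f :
  in_OS_ideal fullv h f -> @ext_hom K _ _ (fun=> @None Z) f = 0.
Proof.
move: f; apply: ideal_ind; [move=> a f g If Ig|move=> r s ds|by rewrite linear0].
  by rewrite linearP /= If Ig scaler0 addr0.
case: s ds => [|x [|y s]] /dependent_size //= _.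
rewrite ext_hom_mul ext_der_gen_mul scale1r (linearB (ext_hom _)) /= !ext_hom_gen_mul /=.
by rewrite !ext_mul0l subr0 ext_mul0r.
Qed.

Lemma sel_size_der n f :
  ext_sel (fun s => size s == n) (D Y f) = D Y (ext_sel (fun s => size s == n.+1) f).
Proof.
have sizeP m : forall s t : seq Y, perm_eq s t -> (size s == m) = (size t == m).
  by move=> s t /perm_size->.
elim/ext_mon_ind: f => [a f g Ef Eg|s]; first by rewrite !linearP /= Ef Eg.
rewrite (ext_sel_mon (sizeP _)) -[D Y (ext_mon K Y s)]ext_mul1l -[ext_one K Y]/(ext_mon K Y [::]).
rewrite ext_mul_mon_der linear_sum (eq_bigr (fun k : 'I_(size s) => if size s == n.+1 then
    (-1) ^+ k *: ext_mon K Y ([::] ++ take k s ++ drop k.+1 s) else 0)) => [|k _].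
  case: ifP => _; last by rewrite big1 ?linear0.
  by rewrite -ext_mul_mon_der ext_mul1l.
rewrite linearZ_LR /= (ext_sel_mon (sizeP _)) size_cat size_take size_drop ltn_ord.
rewrite -(eqSS _ n) -addSn (subnKC (ltn_ord k)).
by case: ifP => _; rewrite ?scaler0.
Qed.

(** Induction on the degree. The flat components of [f] are treated separately, and a hyperplane of
    the subarrangement containing the flat serves as a cone point for the homotopy formula. *)
Lemma subarrangement_inj_deg n f : ext_sel (fun s => size s == n) f = f ->
  in_OS_ideal fullv h (iota f) -> in_OS_ideal fullv h' f.
Proof.
have sizeP m : forall s t : seq Y, perm_eq s t -> (size s == m) = (size t == m).
  by move=> s t /perm_size->.
elim: n f => [|n IHn] f fdeg If.
  (* In degree 0 the augmentation recovers [f] from [iota f], and it kills the ideal. *)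
  suff <-: @ext_hom K _ _ (fun=> @None Y) (iota f) = f.
    by rewrite ideal_augmentation //; exact: ideal0.
  rewrite -[RHS]fdeg; elim/ext_mon_ind: f {fdeg If} => [a f g Ef Eg|[|y s]].
  - by rewrite !linearP /= Ef Eg.
  - rewrite hom_some_mon.
    by rewrite ext_sel_mon ?ext_hom_mon // => ? ? /perm_size->.
  rewrite (ext_sel_mon (sizeP _)).
  by rewrite hom_some_mon /= ext_hom_gen_mul ext_mul0l.
(* A flat is recorded by the members of the subarrangement that contain it, which makes the
   decomposition below a finite sum. *)
pose flat (W : {vspace 'rV[K]_l}) := [set y : Y | (W <= h' y)%VS].
pose sel Z := @ext_sel K Y (fun s => flat (cap_tuple fullv h' s) == Z).
have selP Z : forall s t : seq Y, perm_eq s t ->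
    (flat (cap_tuple fullv h' s) == Z) = (flat (cap_tuple fullv h' t) == Z).
  by move=> s t /(cap_perm fullv h')->.
have -> : f = \sum_Z sel Z f.
  elim/ext_mon_ind: (f) => [a f1 f2 E1 E2|s].
    rewrite {1}E1 {1}E2 scaler_sumr -big_split; apply: eq_bigr => Z _.
    by rewrite /sel linearP.
  rewrite (bigD1 (flat (cap_tuple fullv h' s))) //= big1 ?addr0 => [|Z nZ].
    by rewrite /sel (ext_sel_mon (selP _)) eqxx.
  by rewrite /sel (ext_sel_mon (selP _)) eq_sym (negPf nZ).
apply: ideal_sum => Z _.
have [->|[y yZ]] := set_0Vmem Z.
  (* In positive degree every monomial has a factor, whose hyperplane contains the intersection; so
     the label [set0] does not occur. *)
  suff ->: sel set0 f = 0 by exact: ideal0.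
  rewrite -fdeg /sel; elim/ext_mon_ind: (f) => [a f1 f2 E1 E2|s].
    by rewrite !linearP /= E1 E2 scaler0 addr0.
  rewrite (ext_sel_mon (sizeP _)); case: s => [|y s]; first by rewrite linear0.
  case: ifP => _; last by rewrite linear0.
  rewrite (ext_sel_mon (selP _)); case: eqP => // /setP/(_ y); rewrite !inE.
  by rewrite /cap_tuple big_cons capvSl.
have Ig : in_OS_ideal fullv h (iota (sel Z f)).
  rewrite (_ : iota _ = ext_sel (fun s => flat (cap_tuple fullv h s) == Z) (iota f)).
    exact: (ideal_sel_cap (fun W => flat W == Z)).
  rewrite -hom_some_sel; last by move=> s t /(cap_perm fullv h)->.
  congr (iota _); rewrite /sel; elim/ext_mon_ind: (f) => [a f1 f2 E1 E2|s].
    by rewrite !linearP /= E1 E2.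
  rewrite (ext_sel_mon (selP _)) ext_sel_mon => [|t u tu]; first by rewrite cap_sub_arr.
  by rewrite (cap_perm fullv h (perm_map v tu)).
have gdeg : ext_sel (fun s => size s == n.+1) (sel Z f) = sel Z f.
  rewrite -[in RHS]fdeg /sel; elim/ext_mon_ind: (f) => [a f1 f2 E1 E2|s].
    by rewrite !linearP /= E1 E2.
  rewrite (ext_sel_mon (sizeP _)) (ext_sel_mon (selP _)).
  case: ifP => C1; case: ifP => C2;
  by rewrite ?linear0 ?(ext_sel_mon (sizeP _)) ?(ext_sel_mon (selP _)) ?C1 ?C2.
suff: in_OS_ideal fullv h' (D Y (ext_gen K Y y ** sel Z f)).
  rewrite ext_der_gen_mul scale1r => IDe.
  rewrite -(subrK (ext_gen K Y y ** D Y (sel Z f)) (sel Z f)); apply: idealD IDe _.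
  apply/ideal_mull/IHn; last by rewrite hom_some_der; apply: ideal_der.
  by rewrite sel_size_der gdeg.
rewrite /sel; elim/ext_mon_ind: (f) => [a f1 f2 E1 E2|s].
  by rewrite !linearP; apply: ideal_lin.
rewrite (ext_sel_mon (selP _)); case: eqP => [def_Z|_]; last first.
  by rewrite ext_mul0r linear0; exact: ideal0.
(* Prepending [y] leaves the intersection unchanged, so the codimension is still at most [size s],
   one less than the new length. *)
rewrite -ext_mon_cons; apply: ideal_gen; move: yZ; rewrite -def_Z inE => /capv_idPr sub.
rewrite /dependent_tuple /= ltnS {1}/cap_tuple big_cons sub -(size_map v s).
by have := codim_cap_le (map v s); rewrite -cap_sub_arr.
Qed.

Lemma subarrangement_inj f : in_OS_ideal fullv h (iota f) -> in_OS_ideal fullv h' f.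
Proof.
move=> If; have -> : f = \sum_(n < #|Y|.+1) ext_sel (fun s => size s == n) f.
  move: f {If}; elim/ext_mon_ind => [a f1 f2 E1 E2|s].
    by rewrite {1}E1 {1}E2 scaler_sumr -big_split; apply: eq_bigr => n _; rewrite linearP.
  have sP n : forall s t : seq Y, perm_eq s t -> (size s == n) = (size t == n).
    by move=> u t /perm_size->.
  have [Us|/ext_mon_nuniq->] := boolP (uniq s); last by rewrite big1 // => n _; rewrite linear0.
  have ls : (size s < #|Y|.+1)%N by rewrite ltnS -(card_uniqP Us) max_card.
  rewrite (bigD1 (Ordinal ls)) //= big1 ?addr0 => [|n nn].
    by rewrite (ext_sel_mon (sP _)) eqxx.
  by rewrite (ext_sel_mon (sP _)) eq_sym -[_ == size s]/(n == Ordinal ls) (negPf nn).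
apply: ideal_sum => n _; apply: (@subarrangement_inj_deg n).
  elim/ext_mon_ind: (f) => [a f1 f2 E1 E2|s]; first by rewrite !linearP /= E1 E2.
  have sP : forall s t : seq Y, perm_eq s t -> (size s == n) = (size t == n).
    by move=> u t /perm_size->.
  by rewrite (ext_sel_mon sP); case: ifP => C; rewrite ?linear0 // (ext_sel_mon sP) C.
rewrite (_ : iota _ = ext_sel (fun s => size s == n) (iota f)); first exact: ideal_sel_size.
rewrite -hom_some_sel => [|s t /perm_size->//]; congr (iota _).
elim/ext_mon_ind: (f) => [a f1 f2 E1 E2|s]; first by rewrite !linearP /= E1 E2.
have sP (Z : finType) : forall t u : seq Z, perm_eq t u -> (size t == n) = (size u == n).
  by move=> t u /perm_size->.
by rewrite (ext_sel_mon (sP _)) ext_sel_mon ?size_map // => t u /(perm_map v)/sP.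
Qed.

End Subarrangement.

(** * The residue map *)

Section Residue.
Set Implicit Arguments.
Unset Strict Implicit.
Local Open Scope ring_scope.
Variables (K : fieldType) (l : nat) (X Y Z : finType).
Variables (h : X -> {vspace 'rV[K]_l}) (x0 : X).
Variables (v : Y -> X) (w : Z -> X) (rho : X -> option Z).
Hypothesis hyperplane_h : forall x, (\dim (h x)).+1 = l.
Hypothesis v_neq : forall y, v y != x0.
Hypothesis v_surj : forall x, x != x0 -> exists y, x = v y.
Hypothesis w_neq : forall z, w z != x0.
Hypothesis rho_x0 : rho x0 = None.
Hypothesis wK : pcancel w rho.
Hypothesis rho_cap : forall x, x != x0 ->
  exists2 z, rho x = Some z & (h x :&: h x0 = h (w z) :&: h x0)%VS.
Let h' y := h (v y).
Let h'' z := (h (w z) :&: h x0)%VS.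
Local Notation "f ** g" := (ext_mul K _ f g) (at level 40, left associativity).
Local Notation D Z := (@ext_der K Z (fun=> 1)).
Local Notation I := (in_OS_ideal fullv h).
Local Notation I'' := (in_OS_ideal (h x0) h'').
Local Notation dep := (dependent_tuple fullv h).
Local Notation dep'' := (dependent_tuple (h x0) h'').
Local Notation mon := (ext_mon K X).
Local Notation e_ := (ext_gen K X).
Local Notation iota := (@ext_hom K _ _ (fun y => Some (v y))).
Local Notation psi := (@ext_hom K _ _ (fun z => Some (w z))).
Local Notation p := (@ext_hom K _ _ rho).
Local Notation d := (@ext_der K X (fun x => (x == x0)%:R)).

Definition residue f : ext K Z := p (d f).
HB.instance Definition _ := GRing.Linear.copy residue (p \o d).

Lemma mem_cap_tail s u : u \in h x0 -> x0 \notin s ->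
  all (fun x => u \in h x) (map w (pmap rho s)) = all (fun x => u \in h x) s.
Proof.
move=> ux0; elim: s => //= x s IHs; rewrite inE negb_or eq_sym => /andP[/rho_cap[z -> eq_cap] x0s].
have : (u \in h x :&: h x0)%VS = (u \in h (w z) :&: h x0)%VS by rewrite eq_cap.
by rewrite /= IHs // !memv_cap ux0 !andbT => ->.
Qed.

Lemma size_pmap_rho s : x0 \notin s -> size (pmap rho s) = size s.
Proof.
elim: s => //= x s IHs; rewrite inE negb_or eq_sym => /andP[/rho_cap[z -> _] x0s].
by rewrite /= IHs.
Qed.

(** Codimension in [h x0] is one less than in the whole space, which the additional entry [x0]
    compensates. *)
Lemma dep_restr s : dep'' s = dep (x0 :: map w s).
Proof.
have -> : dep'' s = (\dim (h x0) - \dim (cap_tuple fullv h (x0 :: map w s)) < size s)%N.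
  rewrite /dependent_tuple; congr (_ - \dim _ < _)%N; apply/vspaceP=> u.
  rewrite !mem_cap memvf /= all_map; case ux0: (u \in h x0) => //=.
  by apply: eq_all => z /=; rewrite memv_cap ux0 andbT.
rewrite /dependent_tuple dimvf /dim /= mul1n size_map ltnS.
rewrite -[X in (X - _ <= _)%N](hyperplane_h x0) subSn //.
by rewrite /cap_tuple big_cons dimvS // capvSl.
Qed.

Lemma dep_rho s : x0 \notin s -> dep (x0 :: s) -> dep'' (pmap rho s).
Proof.
move=> x0s; rewrite dep_restr /dependent_tuple /= size_map size_pmap_rho //.
suff -> : cap_tuple fullv h (x0 :: map w (pmap rho s)) = cap_tuple fullv h (x0 :: s) by [].
apply/vspaceP=> u; rewrite !mem_cap memvf /=.
by case ux0: (u \in h x0) => //=; apply: mem_cap_tail.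
Qed.

Lemma dep_cons x s : dep s -> dep (x :: s).
Proof.
rewrite /dependent_tuple /= /cap_tuple big_cons => ds; rewrite ltnS.
rewrite leq_subLR -ltnS -addnS; move: ds; rewrite ltn_subLR; last exact/dimvS/subvf.
move=> ds; apply: (leq_trans ds); rewrite addnS -addSn leq_add2r.
exact: dimv_capv_hyperplane.
Qed.

Lemma proj_mon s : x0 \notin s -> p (mon s) = ext_mon K Z (pmap rho s).
Proof.
elim: s => [_|x s IHs]; first exact: ext_hom_mon.
rewrite inE negb_or eq_sym => /andP[/rho_cap[z rhox _] x0s].
by rewrite ext_mon_cons ext_hom_gen_mul IHs //= rhox.
Qed.

Lemma proj_x0 f : p (e_ x0 ** f) = 0.
Proof. by rewrite ext_hom_gen_mul rho_x0 ext_mul0l. Qed.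

Lemma proj_der s : x0 \notin s -> p (D X (mon s)) = D Z (ext_mon K Z (pmap rho s)).
Proof.
elim: s => [|x s IHs]; first by rewrite !ext_der1 linear0.
rewrite inE negb_or eq_sym => /andP[/rho_cap[z rhox _] x0s].
rewrite ext_mon_cons ext_der_gen_mul scale1r (linearB (ext_hom _)) /= ext_hom_gen_mul IHs //.
by rewrite proj_mon // rhox /= ext_der_gen_mul scale1r.
Qed.

Lemma contract_mon s : x0 \notin s -> d (mon s) = 0.
Proof.
elim: s => [|x s IHs]; first by rewrite ext_der1.
rewrite inE negb_or => /andP[xx0 x0s]; rewrite ext_mon_cons ext_der_gen_mul IHs //.
by rewrite eq_sym (negPf xx0) scale0r ext_mul0r subrr.
Qed.

(** Up to sign, a monomial avoids [x0], begins with its only [x0], or vanishes because [x0] is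
    repeated. *)
Lemma mon_x0_split (P : ext K X -> Prop) s :
  (forall a f, P f -> P (a *: f)) -> P 0 ->
  (x0 \notin s -> P (mon s)) ->
  (forall t, perm_eq s (x0 :: t) -> x0 \notin t -> P (e_ x0 ** mon t)) -> P (mon s).
Proof.
move=> PZ P0 Pout Pin; have [x0s|] := boolP (x0 \in s); last exact: Pout.
have [t [k [st ->]]] := ext_mon_split K x0s; apply: (PZ).
have [x0t|x0t] := boolP (x0 \in t); last exact: Pin.
by rewrite ext_mon_nuniq //= x0t.
Qed.

(** If [x0] is absent, prepending it keeps the tuple dependent, and the result is a relation of the
    restriction. If [x0] occurs, only the term omitting it survives [p], and that term is a
    dependent monomial of the restriction. *)
Lemma proj_der_ideal s : dep s -> I'' (p (D X (mon s))).
Proof.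
move=> ds; apply: (@mon_x0_split (fun f => I'' (p (D X f)))).
- by move=> a f If; rewrite !linearZ_LR; apply: idealZ.
- by rewrite !linear0; exact: ideal0.
- by move=> x0s; rewrite proj_der //; apply/ideal_gen/dep_rho/dep_cons.
move=> t st x0t; rewrite ext_der_gen_mul scale1r (linearB (ext_hom _)) /= proj_x0 subr0.
by rewrite proj_mon //; apply/dep_mon/dep_rho; rewrite // -(dep_perm _ _ st).
Qed.

Lemma proj_der_contract_ideal s : dep s -> I'' (p (D X (d (mon s)))).
Proof.
move=> ds; apply: (@mon_x0_split (fun f => I'' (p (D X (d f))))).
- by move=> a f If; rewrite !linearZ_LR; apply: idealZ.
- by rewrite !linear0; exact: ideal0.
- by move=> x0s; rewrite contract_mon // !linear0; exact: ideal0.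
move=> t st x0t; rewrite ext_der_gen_mul eqxx scale1r contract_mon // ext_mul0r subr0.
by rewrite proj_der //; apply/ideal_gen/dep_rho; rewrite // -(dep_perm _ _ st).
Qed.

(** The contraction [d] anticommutes with the boundary, so the Leibniz rule on [mon r ** D (mon s)]
    leaves exactly the two kinds of terms handled above. *)
Lemma residue_ideal f : I f -> I'' (residue f).
Proof.
move: f; apply: ideal_ind; [move=> a f g If Ig|move=> r s ds|rewrite linear0; exact: ideal0].
  by rewrite linearP; apply: ideal_lin.
rewrite /residue ext_der_mon_mul linearD linearZ_LR /= !ext_hom_mul; apply: idealD.
  by apply/ideal_mull/proj_der_ideal.
apply/idealZ/ideal_mull; rewrite ext_der_anticomm linearN; apply: idealN.
exact: proj_der_contract_ideal.
Qed.

Lemma residue_iota g : residue (iota g) = 0.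
Proof.
elim/ext_mon_ind: g => [a f g Ef Eg|s]; first by rewrite !linearP /= Ef Eg scaler0 addr0.
rewrite /residue hom_some_mon contract_mon ?linear0 //.
by apply/mapP=> -[y _ x0y]; have := v_neq y; rewrite -x0y eqxx.
Qed.

Lemma residue_x0_mul f : residue (e_ x0 ** f) = p f.
Proof.
by rewrite /residue ext_der_gen_mul eqxx scale1r (linearB (ext_hom _)) /= proj_x0 subr0.
Qed.

Lemma proj_psi u : p (psi u) = u.
Proof.
elim/ext_mon_ind: u => [a f g Ef Eg|s]; first by rewrite !linearP /= Ef Eg.
rewrite hom_some_mon proj_mon ?(map_pK wK) //.
by apply/mapP=> -[z _ x0z]; have := w_neq z; rewrite -x0z eqxx.
Qed.

(** The subspace [I + im iota], that is, the preimage of the image of A(A') in A(A). Exactness in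
    the middle is proved by computing modulo it. *)
Definition mod_deletion (f : ext K X) : Prop := exists g, I (f - iota g).
Local Notation Q := mod_deletion.

Lemma mod_deletion_lin a f1 f2 : Q f1 -> Q f2 -> Q (a *: f1 + f2).
Proof.
move=> [g1 I1] [g2 I2]; exists (a *: g1 + g2); rewrite linearP opprD addrACA -scalerBr.
exact: ideal_lin.
Qed.

Lemma mod_deletion_ideal f : I f -> Q f.
Proof. by move=> If; exists 0; rewrite linear0 subr0. Qed.

Lemma mod_deletion0 : Q 0.
Proof. by apply: mod_deletion_ideal; exact: ideal0. Qed.

Lemma mod_deletionZ a f : Q f -> Q (a *: f).
Proof. by move=> Qf; rewrite -[_ *: _]addr0; apply: mod_deletion_lin mod_deletion0. Qed.

Lemma mod_deletionD f g : Q f -> Q g -> Q (f + g).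
Proof. by rewrite -{2}[f]scale1r; apply: mod_deletion_lin. Qed.

Lemma mod_deletionN f : Q f -> Q (- f).
Proof. by rewrite -scaleN1r; apply: mod_deletionZ. Qed.

Lemma mod_deletionB f g : Q f -> Q g -> Q (f - g).
Proof. by move=> Qf /mod_deletionN; apply: mod_deletionD. Qed.

Lemma mod_deletion_gen x f : x != x0 -> Q f -> Q (e_ x ** f).
Proof.
move=> /v_surj[y ->] [g Ig]; exists (ext_gen K Y y ** g).
by rewrite ext_hom_gen_mul -ext_mulBr; apply: ideal_mull.
Qed.

Lemma mod_deletion_mon_mul s f : x0 \notin s -> Q f -> Q (mon s ** f).
Proof.
move=> x0s Qf; elim: s x0s => [|x s IHs]; first by rewrite ext_mul1l.
rewrite inE negb_or eq_sym => /andP[xx0 /IHs Qs]; rewrite ext_mon_cons -ext_mulA.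
exact: mod_deletion_gen.
Qed.

Lemma mod_deletion_one : Q (ext_one K X).
Proof.
exists (ext_one K Y); rewrite [iota _](hom_some_mon K v [::]) subrr; exact: ideal0.
Qed.

Lemma mod_deletion_mon s : x0 \notin s -> Q (mon s).
Proof.
move=> x0s; rewrite -[mon s]ext_mul1r; apply: mod_deletion_mon_mul => //.
exact: mod_deletion_one.
Qed.

(** The three hyperplanes meet in the intersection of the first two, which has codimension at most
    2. *)
Lemma dep_pencil x z : (h x :&: h x0 = h (w z) :&: h x0)%VS -> dep [:: x0; x; w z].
Proof.
move=> eq_cap; rewrite /dependent_tuple ltnS.
suff -> : cap_tuple fullv h [:: x0; x; w z] = cap_tuple fullv h [:: x0; x].
  exact: codim_cap_le.
apply/vspaceP=> u; rewrite !mem_cap /= !andbT.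
have : (u \in h x :&: h x0)%VS = (u \in h (w z) :&: h x0)%VS by rewrite eq_cap.
rewrite !memv_cap.
by case: (u \in h x0); rewrite ?andbF //= !andbT => <-; rewrite andbb.
Qed.

(* The relation of [x0, x, w z] lets one replace [x] by [w z] after [x0]. *)
Lemma mod_deletion_x0_mon s : x0 \notin s -> Q (e_ x0 ** (mon s - psi (p (mon s)))).
Proof.
elim: s => [_|x s IHs].
  by rewrite proj_mon // hom_some_mon subrr ext_mul0r; exact: mod_deletion0.
rewrite inE negb_or eq_sym => /andP[xx0 x0s]; have [y rhox eq_cap] := rho_cap xx0.
rewrite ext_mon_cons !ext_hom_gen_mul rhox /=.
rewrite ext_hom_gen_mul /=; set z := w y; set m := mon s; set m' := psi _.
(* Splits [e_x m - e_z m'] as [(e_x - e_z) m + e_z (m - m')]; the minus sign comes from exchanging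
   [e_ x0] and [e_ z]. *)
rewrite (_ : _ ** _ = e_ x0 ** (e_ x - e_ z) ** m - e_ z ** (e_ x0 ** (m - m'))); last first.
  rewrite [e_ z ** (_ ** _)]ext_mulA [e_ z ** e_ x0]ext_genC ext_mulNl opprK -!ext_mulA -ext_mulDr.
  by congr (_ ** _); rewrite ext_mulBl ext_mulBr addrA subrK.
apply: mod_deletionB; last by apply: mod_deletion_gen (IHs x0s); apply: w_neq.
(* The boundary of [[:: x0; x; z]] is [e_x e_z + e_x0 (e_x - e_z)]. *)
rewrite (_ : _ ** _ = D X (mon [:: x0; x; z]) ** m - mon (x :: z :: s)).
  apply: mod_deletionB; last first.
    by apply: mod_deletion_mon; rewrite !inE eq_sym (negPf xx0) eq_sym (negPf (w_neq _)).
  by apply/mod_deletion_ideal/ideal_mulr/ideal_gen/dep_pencil.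
rewrite /= !ext_der_gen_mul ext_der1 !scale1r !ext_mul0r !subr0 !ext_mul1r.
by rewrite ext_mulBl ext_mulA addrAC subrr add0r -ext_mulNl -ext_mulNr opprB.
Qed.

(** For [f = g + e_x0 g'] with [g] and [g'] free of [x0], the residue is [p g'], and [e_x0 g']
    agrees with [e_x0 psi (p g')] by the replacement just proved. *)
Lemma mod_deletion_residue f : Q (f - e_ x0 ** psi (residue f)).
Proof.
elim/ext_mon_ind: f => [a f g Qf Qg|s].
  rewrite (linearP residue) /= (linearP (ext_hom _)) /= ext_mulDr ext_mulZr opprD addrACA.
  by rewrite -scalerBr; apply: (mod_deletion_lin a Qf Qg).
apply: (@mon_x0_split (fun f => Q (f - e_ x0 ** psi (residue f)))).
- move=> a f Qf; rewrite (linearZ_LR residue) /= (linearZ_LR (ext_hom _)) /= ext_mulZr -scalerBr.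
  exact: mod_deletionZ Qf.
- by rewrite !linear0 addr0; exact: mod_deletion0.
- move=> x0s; rewrite /residue contract_mon // !linear0 addr0; exact: mod_deletion_mon.
by move=> t _ x0t; rewrite residue_x0_mul -ext_mulBr; apply: mod_deletion_x0_mon.
Qed.

(** For the lift [m] of a dependent monomial of the restriction, [e_x0 D m = m - D (e_x0 m)]: here
    [m] avoids [x0], and [D (e_x0 m)] is a relation of the full arrangement. *)
Lemma mod_deletion_x0_ideal u : I'' u -> Q (e_ x0 ** psi u).
Proof.
move: u; apply: ideal_ind => [a f g Qf Qg|r s ds|]; last by rewrite !linear0; exact: mod_deletion0.
  by rewrite !linearP; apply: mod_deletion_lin.
have x0w t : x0 \notin map w t.
  by apply/mapP=> -[z _ x0z]; have := w_neq z; rewrite -x0z eqxx.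
rewrite ext_hom_mul hom_some_der !hom_some_mon ext_mulA.
rewrite -[e_ x0 ** _](signrZK (size (map w r))) -ext_mon_mul_gen ext_mulZl; apply: mod_deletionZ.
rewrite -ext_mulA (_ : e_ x0 ** _ = mon (map w s) - D X (mon (x0 :: map w s))); last first.
  by rewrite ext_der_gen_mul scale1r opprB addrC subrK.
apply: mod_deletion_mon_mul => //; apply: mod_deletionB; first exact: mod_deletion_mon.
by apply/mod_deletion_ideal/ideal_gen; rewrite -dep_restr.
Qed.

Lemma residue_exact f : I'' (residue f) -> exists g, I (f - iota g).
Proof.
move=> /mod_deletion_x0_ideal Qr.
by have := mod_deletionD (mod_deletion_residue f) Qr; rewrite subrK.
Qed.

Lemma residue_surj u : residue (e_ x0 ** psi u) = u.
Proof. by rewrite residue_x0_mul proj_psi. Qed.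

End Residue.

(** * Bases modulo a subspace *)

Section BasisModulo.
Set Implicit Arguments.
Unset Strict Implicit.
Local Open Scope ring_scope.
Variables (K : fieldType).

(** For a subspace [I] and duplicate-free [cs], this says that [b] induces a basis of [V / I],
    without forming the quotient. *)
Definition basis_modulo (V : lmodType K) (I : V -> Prop) (C : eqType) (cs : seq C)
    (b : C -> V) : Prop :=
  (forall lam : C -> K, I (\sum_(c <- cs) lam c *: b c) -> {in cs, forall c, lam c = 0}) /\
  (forall x, exists lam : C -> K, I (x - \sum_(c <- cs) lam c *: b c)).

Lemma basis_modulo_ext (V : lmodType K) (I : V -> Prop) (C : eqType) (cs : seq C) (b1 b2 : C -> V) :
  b1 =1 b2 -> basis_modulo I cs b1 <-> basis_modulo I cs b2.
Proof.
move=> eqb; have eqs (lam : C -> K) : \sum_(c <- cs) lam c *: b1 c = \sum_(c <- cs) lam c *: b2 c.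
  by apply: eq_bigr => c _; rewrite eqb.
split=> -[inj surj]; split=> [lam|x].
- by rewrite -eqs; apply: inj.
- by have [lam] := surj x; rewrite eqs; exists lam.
- by rewrite eqs; apply: inj.
- by have [lam] := surj x; rewrite -eqs; exists lam.
Qed.

Lemma extend_family (B C : eqType) (cs : seq B) (k : B -> C) (lam : B -> K) :
  uniq (map k cs) -> exists mu : C -> K, {in cs, forall c, mu (k c) = lam c}.
Proof.
elim: cs => [_|c cs IHcs /= /andP[kc /IHcs[mu Hmu]]]; first by exists (fun=> 0).
exists (fun t => if t == k c then lam c else mu t) => c'.
rewrite inE => /predU1P[->|c'cs]; first by rewrite eqxx.
by case: eqP => [kc'|_]; [rewrite -kc' map_f in kc|apply: Hmu].
Qed.

Lemma basis_modulo_reindex (V : lmodType K) (I : V -> Prop) (B C : eqType) (cs : seq B)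
    (ts : seq C) (k : B -> C) (b : C -> V) :
  perm_eq (map k cs) ts -> uniq ts ->
  basis_modulo I ts b <-> basis_modulo I cs (b \o k).
Proof.
move=> kcs Uts; have Ukcs : uniq (map k cs) by rewrite (perm_uniq kcs).
have sumE (lam : C -> K) : \sum_(t <- ts) lam t *: b t = \sum_(c <- cs) lam (k c) *: b (k c).
  by rewrite -(perm_big _ kcs) big_map.
have ext (lam : B -> K) : exists mu : C -> K, {in cs, forall c, mu (k c) = lam c} /\
    \sum_(c <- cs) lam c *: b (k c) = \sum_(t <- ts) mu t *: b t.
  have [mu Hmu] := extend_family lam Ukcs; exists mu; split=> //; rewrite sumE.
  by apply: eq_big_seq => c /Hmu->.
split=> -[inj surj]; split.
- move=> lam; have [mu [Hmu ->]] := ext lam => /inj mu0 c ccs.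
  by rewrite -Hmu // mu0 // -(perm_mem kcs) map_f.
- by move=> x; have [lam] := surj x; rewrite sumE; exists (lam \o k).
- move=> lam; rewrite sumE => /(inj (lam \o k)) lam0 t.
  by rewrite -(perm_mem kcs) => /mapP[c ccs ->]; apply: lam0.
- by move=> x; have [lam] := surj x; have [mu [_ ->]] := ext lam; exists mu.
Qed.

(** * The short five lemma in terms of bases *)

Section ShortFive.
Variables (V' V V'' : lmodType K) (I' : V' -> Prop) (I : V -> Prop) (I'' : V'' -> Prop).
Variables (iota : {linear V' -> V}) (J : {linear V -> V''}).
Hypothesis I_lin : forall a f g, I f -> I g -> I (a *: f + g).
Hypothesis I''_lin : forall a f g, I'' f -> I'' g -> I'' (a *: f + g).
Hypothesis I''0 : I'' 0.
Hypothesis iota_I : forall f, I' f -> I (iota f).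
Hypothesis iota_inj : forall f, I (iota f) -> I' f.
Hypothesis J_I : forall f, I f -> I'' (J f).
Hypothesis J_iota : forall g, J (iota g) = 0.
Hypothesis J_exact : forall f, I'' (J f) -> exists g, I (f - iota g).
Hypothesis J_surj : forall u, exists f, J f = u.
Variables (C' C'' : eqType) (cs' : seq C') (cs'' : seq C'').
Variables (b' : C' -> V') (b'' : C'' -> V'') (c'' : C'' -> V).
Hypothesis J_c'' : forall c, J (c'' c) = b'' c.

Definition glue_basis (c : C' + C'') : V :=
  match c with inl c => iota (b' c) | inr c => c'' c end.
Definition glue_seq : seq (C' + C'') := map inl cs' ++ map inr cs''.

Let sum' (lam : C' -> K) := \sum_(c <- cs') lam c *: b' c.
Let sum'' (lam : C'' -> K) := \sum_(c <- cs'') lam c *: c'' c.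
Let sumJ (lam : C'' -> K) := \sum_(c <- cs'') lam c *: b'' c.

Lemma glue_sum (lam : C' + C'' -> K) :
  \sum_(c <- glue_seq) lam c *: glue_basis c = iota (sum' (lam \o inl)) + sum'' (lam \o inr).
Proof.
rewrite big_cat !big_map /= /sum' linear_sum; congr (_ + _).
by apply: eq_bigr => c _; rewrite linearZ_LR.
Qed.

Lemma J_sum'' lam : J (sum'' lam) = sumJ lam.
Proof. by rewrite linear_sum; apply: eq_bigr => c _; rewrite linearZ_LR /= J_c''. Qed.

Lemma J_glue lam mu : J (iota (sum' lam) + sum'' mu) = sumJ mu.
Proof. by rewrite linearD J_iota add0r J_sum''. Qed.

Let pair_coef (lam : C' -> K) (mu : C'' -> K) (c : C' + C'') :=
  match c with inl c => lam c | inr c => mu c end.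

Lemma I_add f g : I f -> I g -> I (f + g).
Proof. by rewrite -{2}[f]scale1r; apply: I_lin. Qed.

Lemma glueP : basis_modulo I glue_seq glue_basis <->
  (forall lam mu, I (iota (sum' lam) + sum'' mu) ->
     {in cs', forall c, lam c = 0} /\ {in cs'', forall c, mu c = 0}) /\
  (forall f, exists lam mu, I (f - (iota (sum' lam) + sum'' mu))).
Proof.
split=> -[inj surj]; split.
- move=> lam mu Is; have := inj (pair_coef lam mu); rewrite glue_sum => /(_ Is) z.
  split=> c ccs.
    by apply: (z (inl c)); rewrite mem_cat map_f.
  by apply: (z (inr c)); rewrite mem_cat orbC map_f.
- by move=> f; have [lam] := surj f; rewrite glue_sum; exists (lam \o inl), (lam \o inr).
- move=> lam; rewrite glue_sum => /inj[z' z''] c.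
  by rewrite mem_cat => /orP[] /mapP[c1 c1cs ->]; [exact: z'|exact: z''].
- move=> f; have [lam [mu Is]] := surj f; exists (pair_coef lam mu).
  by rewrite glue_sum.
Qed.

Lemma sum''0 mu : {in cs'', forall c, mu c = 0} -> sum'' mu = 0.
Proof. by move=> mu0; apply: big1_seq => c /= ccs; rewrite mu0 ?scale0r. Qed.

(** The glued family consists of the images of [b'] and of lifts of [b'']. Applying [J] isolates the
    second group of coefficients, and exactness returns what is left to [V']. *)
Lemma short_five : let i := basis_modulo I glue_seq glue_basis in
  let ii := basis_modulo I' cs' b' in let iii := basis_modulo I'' cs'' b'' in
  [/\ (i -> ii -> iii), (i -> iii -> ii) & (ii -> iii -> i)].
Proof.
split.
- move=> /glueP[inj surj] [_ surj']; split=> [mu|u].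
    rewrite -/(sumJ mu) -J_sum'' => /J_exact[g Ig].
    have [lam Ilam] := surj' g.
    (* The lifted relation equals [iota g] modulo [I]; subtracting the expansion of [g] turns it
       into a relation of the glued family. *)
    have [] // := inj (fun c => - lam c) mu.
    have := I_add Ig (iota_I Ilam); rewrite linearB addrA subrK addrC.
    rewrite (_ : sum' (fun c => - lam c) = - sum' lam) ?linearN //.
    by rewrite /sum' -sumrN; apply: eq_bigr => c _; rewrite scaleNr.
  have [f <-] := J_surj u; have [lam [mu /J_I]] := surj f.
  by rewrite linearB J_glue; exists mu.
- move=> /glueP[inj surj] [inj'' _]; split=> [lam Ilam|g].
    have [] // := inj lam (fun=> 0).
    by rewrite sum''0 // addr0; apply: iota_I.
  have [lam [mu Is]] := surj (iota g); exists lam.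
  (* As [J] kills [iota g], the lifted part of its expansion maps to a relation among the [b'']. *)
  have: I'' (sumJ mu).
    have := J_I Is; rewrite linearB J_glue J_iota add0r => /(I''_lin (-1))/(_ I''0).
    by rewrite scaleN1r opprK addr0.
  move=> /inj'' mu0; apply: iota_inj.
  by move: Is; rewrite sum''0 // addr0 -linearB.
move=> [inj' surj'] [inj'' surj'']; apply/glueP; split=> [lam mu Is|f].
  have mu0 : {in cs'', forall c, mu c = 0} by apply: inj''; have := J_I Is; rewrite J_glue.
  split=> //; apply: inj'; apply: iota_inj.
  by move: Is; rewrite sum''0 // addr0.
(* First [J f] is expanded; the difference of [f] and the lifted expansion comes from [V'] by
   exactness and is expanded there. *)
have [mu] := surj'' (J f); rewrite -/(sumJ mu) -J_sum'' -linearB => /J_exact[g Ig].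
have [lam /iota_I Ilam] := surj' g; exists lam, mu.
have := I_add Ig Ilam; rewrite linearB addrA subrK.
by rewrite opprD addrA addrAC.
Qed.

End ShortFive.
End BasisModulo.

(** * Pure tensors as sequences of choices *)

Section Kappa.
Set Implicit Arguments.
Unset Strict Implicit.
Local Open Scope ring_scope.

(** One entry per block, [None] standing for the factor 1. With sequences, passing to partitions
    with fewer blocks is an operation on lists and avoids reindexing ordinals. *)
Fixpoint choices (X : finType) (P : seq {set X}) : seq (seq (option X)) :=
  if P is B :: P' then [seq o :: t | o <- None :: map Some (enum B), t <- choices P']
  else [:: [::]].

Definition choice_ok (X : finType) (B : {set X}) (o : option X) :=
  if o is Some x then x \in B else true.

Lemma choices_uniq (X : finType) (P : seq {set X}) : uniq (choices P).
Proof.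
elim: P => // B P IHP; apply: allpairs_uniq => //.
  rewrite /= (map_inj_uniq Some_inj) enum_uniq andbT.
  by apply/mapP=> -[].
by move=> [o t] [o' t'] _ _ [-> ->].
Qed.

Lemma mem_choices_cons (X : finType) (B : {set X}) P o t :
  (o :: t \in choices (B :: P)) = choice_ok B o && (t \in choices P).
Proof.
have -> : choice_ok B o = (o \in None :: map Some (enum B)).
  case: o => [x|] //; rewrite inE /= (mem_map Some_inj) mem_enum //.
apply/allpairsP/andP => [[[o' t'] [/= o'B t'P [-> ->]]]|[oB tP]] //.
by exists (o, t).
Qed.

Lemma mem_choices (X : finType) (P : seq {set X}) t :
  reflect (size t = size P /\ forall i, (i < size P)%N -> choice_ok (nth set0 P i) (nth None t i))
          (t \in choices P).
Proof.
elim: P t => [|B P IHP] [|o t].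
- by rewrite inE; left.
- by rewrite inE; right=> -[].
- by apply: (iffP idP) => [/allpairsP[[? ?] [_ _]]|[]].
rewrite mem_choices_cons; apply: (iffP andP) => [[oB /IHP[st tP]]|[[st] tP]].
  by split=> [|[|i]] //=; [rewrite st|apply: tP].
by split; [exact: (tP 0%N)|apply/IHP; split=> // i; apply: (tP i.+1)].
Qed.

Variables (K : fieldType) (l : nat) (U : {vspace 'rV[K]_l}).
Variables (X : finType) (h : X -> {vspace 'rV[K]_l}).

Lemma kappa_mon_codom (P : seq {set X}) c :
  kappa_mon K X P c = ext_mon K X (pmap id (codom c)).
Proof.
rewrite /kappa_mon /codom /image_mem.
transitivity (\big[ext_mul K X/ext_one K X]_(i <- enum 'I_(size P))
    (if c i is Some x then ext_gen K X x else ext_one K X)).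
  by rewrite enumT [index_enum _]unlock.
elim: (enum _) => [|i s IHs]; first by rewrite big_nil.
by rewrite big_cons IHs /=; case: (c i) => [x|] /=; rewrite ?ext_mul1l.
Qed.

(** Reading a function on ['I_(size P)] as its list of values identifies the valid choices with
    [choices P]. *)
Lemma kappa_iso_choices (P : seq {set X}) :
  kappa_iso U h P <->
  basis_modulo (in_OS_ideal U h) (choices P) (fun t => ext_mon K X (pmap id t)).
Proof.
pose code (c : {ffun 'I_(size P) -> option X}) : seq (option X) := codom c.
pose cs := enum [pred c | choice_valid X P c].
have codeE (c : {ffun 'I_(size P) -> option X}) i : nth None (code c) i = 
    if insub i is Some j then c j else None.
  case: insubP => [j _ <-|].
    by rewrite /code /codom /image_mem (nth_map j) ?size_enum_ord ?ltn_ord // nth_ord_enum.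
  by rewrite -leqNgt => Pi; rewrite nth_default // size_codom card_ord.
have perm_cs : perm_eq (map code cs) (choices P).
  apply: uniq_perm (choices_uniq P) _.
    rewrite map_inj_uniq ?enum_uniq // => c c' cc'; apply/ffunP=> i.
    by have := codeE c i; rewrite cc' codeE valK.
  move=> t; apply/mapP/mem_choices => [[c]|[st tP]].
    rewrite mem_enum => /forallP cP ->; rewrite size_codom card_ord; split=> // i iP.
    by rewrite codeE insubT; apply: cP.
  exists [ffun i : 'I_(size P) => nth None t i].
    by rewrite mem_enum; apply/forallP=> i; rewrite ffunE; apply: tP.
  apply: (@eq_from_nth _ None); first by rewrite size_codom card_ord st.
  by move=> i; rewrite st => iP; rewrite codeE insubT ffunE.
apply: iff_trans _ (iff_sym (basis_modulo_reindex _ _ perm_cs (choices_uniq P))).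
have kE lam : kappa K X P lam =
    \sum_(c <- cs) lam c *: ext_mon K X (pmap id (code c)).
  by rewrite big_enum; apply: eq_bigr => c _; rewrite kappa_mon_codom.
split=> -[inj surj]; split.
- by move=> lam; rewrite -kE => /inj lam0 c; rewrite mem_enum; apply: lam0.
- by move=> x; have [lam] := surj x; rewrite kE; exists lam.
- by move=> lam; rewrite kE => /inj lam0 c vc; apply: lam0; rewrite mem_enum.
- by move=> x; have [lam] := surj x; rewrite -kE; exists lam.
Qed.

End Kappa.

(** * Tensor bases of the triple *)

Section Restriction.
Set Implicit Arguments.
Unset Strict Implicit.

Section Preimage.
Variables (X Y : finType) (v : Y -> X).

Definition preim_block (B : {set X}) : {set Y} := [set y | v y \in B].

Lemma choice_ok_preim B o : choice_ok B (omap v o) = choice_ok (preim_block B) o.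
Proof. by case: o => //= y; rewrite inE. Qed.

Lemma mem_choices_preim P t :
  (map (omap v) t \in choices P) = (t \in choices (map preim_block P)).
Proof.
elim: P t => [|B P IHP] [|o t]; rewrite ?map_cons.
- by rewrite !inE.
- by rewrite !inE.
- by apply/idP/idP=> /mem_choices[].
by rewrite !mem_choices_cons choice_ok_preim IHP.
Qed.

Lemma choices_preim_surj (P : seq {set X}) t :
  (forall B x, B \in P -> x \in B -> exists y, x = v y) -> t \in choices P ->
  exists2 t', t' \in choices (map preim_block P) & t = map (omap v) t'.
Proof.
move=> vP tP; suff [t' et'] : exists t', t = map (omap v) t'.
  by exists t'; rewrite // -mem_choices_preim -et'.
elim: P t vP tP => [|B P IHP] t vP; first by rewrite inE => /eqP->; exists [::].
case: t => [|o t]; first by case/mem_choices.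
rewrite mem_choices_cons => /andP[oB /IHP[|t' ->]].
  by move=> B' x B'P; apply: vP; rewrite inE B'P orbT.
case: o oB => [x|_]; last by exists (None :: t').
by case/(vP B x (mem_head _ _)) => y ->; exists (Some y :: t').
Qed.

Lemma pmap_omap (t : seq (option Y)) : pmap id (map (omap v) t) = map v (pmap id t).
Proof. by elim: t => //= -[y|] t /= ->. Qed.

End Preimage.

Section Partition.
Variables (X : finType) (x0 : X) (B0 : {set X}) (P : seq {set X}).
Hypothesis x0B0 : x0 \in B0.
Hypothesis P_partition : is_partition (B0 :: P).

Local Notation v := (val : idx' x0 -> X).
Local Notation w := (val : idx'' B0 -> X).

Lemma block_disjoint B x : B \in P -> x \in B -> x \notin B0.
Proof.
move=> BP xB; have [_ [disj _]] := P_partition.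
have := disj 0 (index B P).+1; rewrite /= ltnS index_mem BP nth_index // => /(_ isT).
by move=> /pred0P/(_ x)/=; rewrite xB andbT => ->.
Qed.

Lemma block_notin B : B \in P -> x0 \notin B.
Proof. by move=> BP; apply/negP=> /(block_disjoint BP); rewrite x0B0. Qed.

(** Only the first block can become empty when [x0] is deleted, since the other blocks are non-empty
    and avoid [x0]. *)
Lemma part'E : part' x0 (B0 :: P) =
  if preim_block v B0 == set0 then map (preim_block v) P
  else preim_block v B0 :: map (preim_block v) P.
Proof.
rewrite /part' /= -/(preim_block v B0) (all_filterP _); first by case: (_ == set0).
apply/allP=> _ /mapP[B BP ->]; have [/allP/(_ B) + _] := P_partition.
rewrite inE BP orbT => /(_ isT)/set0Pn[x xB]; apply/set0Pn.
have xx0 : x != x0 by apply: contraTneq xB => ->; apply: block_notin.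
by exists (Sub x xx0); rewrite inE SubK.
Qed.

Lemma part''E : part'' B0 (B0 :: P) = map (preim_block w) P.
Proof. by []. Qed.

(** If the first block was the singleton of [x0], it is missing from the induced partition, and its
    factor 1 is reinserted as [None]. Choices for the restriction receive the factor of [x0] in the
    first block. *)
Definition lift_choice (c : seq (option (idx' x0)) + seq (option (idx'' B0))) :
    seq (option X) :=
  match c with
  | inl t => if preim_block v B0 == set0 then None :: map (omap v) t else map (omap v) t
  | inr t => Some x0 :: map (omap w) t
  end.

Lemma lift_choice_inj : injective lift_choice.
Proof.
have injv : injective (omap v) by apply/inj_omap/val_inj.
have injw : injective (omap w) by apply/inj_omap/val_inj.
have vne o : omap v o <> Some x0.
  by case: o => //= y [] yx0; case/negP: (valP y); apply/eqP.
have ne t t' : lift_choice (inl t) <> lift_choice (inr t').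
  by rewrite /=; case: ifP => // _; case: t => //= o t [/vne].
case=> [t|t] [t'|t'] //; [|by move/ne|by move/esym/ne|].
- by rewrite /=; case: ifP => _; [case|]; move/(inj_map injv) => ->.
- by case=> /(inj_map injw) ->.
Qed.

(** A choice for the full partition either takes [x0] in the first block or avoids [x0] altogether,
    as no other block contains it. *)
Lemma lift_choice_perm :
  perm_eq
    (map lift_choice
      (glue_seq (choices (part' x0 (B0 :: P))) (choices (part'' B0 (B0 :: P)))))
    (choices (B0 :: P)).
Proof.
apply: uniq_perm (choices_uniq _) _.
  rewrite (map_inj_uniq lift_choice_inj) cat_uniq !map_inj_uniq ?choices_uniq ?andbT //=;
    try by move=> ? ? [].
  by apply/hasPn=> _ /mapP[t _ ->]; apply/mapP=> -[].
have PB B x : B \in P -> x \in B -> exists y, x = v y.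
  move=> BP xB; have xx0 : x != x0 by apply: contraTneq xB => ->; apply: block_notin.
  by exists (Sub x xx0); rewrite SubK.
move=> t; rewrite part'E part''E; apply/mapP/idP => [[[t'|t']]|].
- rewrite mem_cat => /orP[/mapP[t1 + [->]]|/mapP[]//] ->.
  rewrite /lift_choice; case: ifP => _ t1P; first by rewrite mem_choices_cons mem_choices_preim.
  by rewrite (mem_choices_preim v (B0 :: P)).
- rewrite mem_cat => /orP[/mapP[]//|/mapP[t1 t1P [->]]] ->.
  by rewrite mem_choices_cons mem_choices_preim /= x0B0.
case: t => [|o t]; first by case/mem_choices.
rewrite mem_choices_cons => /andP[oB tP]; have [ox0|ox0] := eqVneq o (Some x0).
  have [|t' t'P ->] := @choices_preim_surj _ _ w P t _ tP.
    by move=> B x BP xB; exists (Sub x (block_disjoint BP xB)); rewrite SubK.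
  by exists (inr t'); rewrite ?ox0 // mem_cat orbC map_f.
have [t' t'P ->] := choices_preim_surj PB tP.
have [o' eo] : exists o', o = omap v o'.
  case: o ox0 {oB} => [x|_]; last by exists None.
  by rewrite (inj_eq Some_inj) => xx0; exists (Some (Sub x xx0)).
case: ifP => B0e.
  exists (inl t'); first by rewrite mem_cat map_f.
  (* Without [x0] the first block is empty here, so its entry must be [None]. *)
  rewrite /= B0e eo; case: o' eo => //= y oy; move: oB; rewrite oy /= => yB.
  by move/eqP/setP/(_ y): B0e; rewrite !inE yB.
exists (inl (o' :: t')); last by rewrite /= B0e eo.
by rewrite mem_cat map_f // mem_choices_cons t'P andbT -choice_ok_preim -eo.
Qed.

End Partition.

(* The value [None] at [x0] covers the case where [A''] is empty. *)
Lemma restriction_section (K : fieldType) l (X : finType) (h : X -> {vspace 'rV[K]_l}) x0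
    (B0 : {set X}) : x0 \in B0 -> restriction_bijective h x0 B0 ->
  exists rho : X -> option (idx'' B0), [/\ rho x0 = None, pcancel val rho &
    forall x, x != x0 ->
      exists2 z, rho x = Some z & (h x :&: h x0 = h (val z) :&: h x0)%VS].
Proof.
move=> x0B0 [inj surj].
exists (fun x => if x == x0 then None
  else [pick z : idx'' B0 | (h x :&: h x0)%VS == (h (val z) :&: h x0)%VS]).
split=> [|z|x xx0]; first by rewrite eqxx.
  have zx0 : val z != x0 by apply: contraTneq x0B0 => <-; apply: (valP z).
  rewrite (negPf zx0); case: pickP => [z' /eqP ezz'|/(_ z)]; last by rewrite eqxx.
  by congr Some; apply/val_inj/esym/inj => //; [exact: (valP z)|exact: (valP z')].
rewrite (negPf xx0); have [y yB0 exy] := surj x xx0.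
case: pickP => [z /eqP exz|/(_ (Sub y yB0))]; first by exists z.
by rewrite SubK exy eqxx.
Qed.

End Restriction.

(** * Two out of three for the triple *)

Theorem theorem1p1 (K : fieldType) (l : nat) (X : finType)
  (h : X -> {vspace 'rV[K]_l}) (pi : seq {set X}) (x0 : X) :
  injective h ->
  (forall x, (\dim (h x)).+1 = l) ->
  is_partition pi ->
  x0 \in nth set0 pi 0 ->
  restriction_bijective h x0 (nth set0 pi 0) ->
  let i := kappa_iso fullv h pi in
  let ii := kappa_iso fullv (fam' h x0) (part' x0 pi) in
  let iii := kappa_iso (h x0) (fam'' h x0 (nth set0 pi 0)) (part'' (nth set0 pi 0) pi) in
  [/\ (i -> ii -> iii), (i -> iii -> ii) & (ii -> iii -> i)].
Proof.
(* For an empty sequence the first block defaults to [set0], which cannot contain [x0]. *)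
move=> _ hyp_h; case: pi => [|B0 P] pi_part; first by rewrite inE.
rewrite [nth _ _ _]/= => x0B0 restr; move=> i ii iii.
have [rho [rho_x0 wK rho_cap]] := restriction_section x0B0 restr.
have v_neq (y : idx' x0) : val y != x0 := valP y.
have v_surj x : x != x0 -> exists y : idx' x0, x = val y.
  by move=> xx0; exists (Sub x xx0); rewrite SubK.
have w_neq (z : idx'' B0) : val z != x0 by apply: contraTneq x0B0 => <-; apply: (valP z).
(* A linear section of the residue; it turns the tensor basis of the restriction into the tensors of
   [pi] that involve [x0], up to relabelling. *)
pose lift u := ext_mul K X (ext_gen K X x0) (@ext_hom K (idx'' B0) X (fun z => Some (val z)) u).
have liftK u : residue x0 rho (lift u) = u := residue_surj w_neq rho_x0 wK rho_cap u.
pose c'' (t : seq (option (idx'' B0))) := lift (ext_mon K _ (pmap id t)).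
pose iota := @ext_hom K _ _ (fun y : idx' x0 => Some (val y)).
have eq_i : i <-> basis_modulo (in_OS_ideal fullv h)
    (glue_seq (choices (part' x0 (B0 :: P))) (choices (part'' B0 (B0 :: P))))
    (glue_basis iota (fun t => ext_mon K _ (pmap id t)) c'').
  apply: iff_trans (kappa_iso_choices _ _ _) _.
  apply: iff_trans (basis_modulo_reindex _ _ (lift_choice_perm x0B0 pi_part) (choices_uniq _)) _.
  apply: basis_modulo_ext => -[t|t] /=.
    (* [pmap id] discards a reinserted [None], so both cases of [lift_choice] give the same
       monomial. *)
    by rewrite [RHS]hom_some_mon -pmap_omap; case: ifP.
  by rewrite /c'' /lift hom_some_mon -pmap_omap.
have eq_ii : ii <-> _ := kappa_iso_choices _ _ _.
have eq_iii : iii <-> _ := kappa_iso_choices _ _ _.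
suff [i_ii i_iii ii_iii] : let i := basis_modulo (in_OS_ideal fullv h)
    (glue_seq (choices (part' x0 (B0 :: P))) (choices (part'' B0 (B0 :: P))))
    (glue_basis iota (fun t => ext_mon K _ (pmap id t)) c'') in
  let ii := basis_modulo (in_OS_ideal fullv (fam' h x0)) (choices (part' x0 (B0 :: P)))
    (fun t => ext_mon K _ (pmap id t)) in
  let iii := basis_modulo (in_OS_ideal (h x0) (fam'' h x0 B0)) (choices (part'' B0 (B0 :: P)))
    (fun t => ext_mon K _ (pmap id t)) in
  [/\ (i -> ii -> iii), (i -> iii -> ii) & (ii -> iii -> i)].
  split=> [/eq_i Hi /eq_ii Hii|/eq_i Hi /eq_iii Hiii|/eq_ii Hii /eq_iii Hiii].
  - exact/eq_iii/i_ii.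
  - exact/eq_ii/i_iii.
  - exact/eq_i/ii_iii.
refine (short_five (I' := in_OS_ideal fullv (fam' h x0)) (J := residue x0 rho)
  _ _ _ _ _ _ _ _ _ _ _ _ _).
- exact: ideal_lin.
- exact: ideal_lin.
- exact: ideal0.
- by move=> f; apply: hom_some_ideal.
- by move=> f; apply: subarrangement_inj.
- by move=> f; apply: residue_ideal.
- by move=> g; apply: residue_iota.
- by move=> f; apply: residue_exact.
- by move=> u; exists (lift u); apply: liftK.
- by move=> t; apply: liftK.
Qed.
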